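(* Let $(x_n)_{n\ge1}$ be a sequence of real numbers (considered modulo 1) with discrepancy $D_N$, and let $M_N=\max_{n\le N} nD_n$. Let $g:(0,\infty)\to(0,\infty)$ be monotonically decreasing with $\lim_{N\to\infty} g(N)/D_N=\infty$, $\lim_{N\to\infty} N g(N)=\infty$, and $$\lim_{N\to\infty}\frac{g\!\left(N\left(1+\frac{M_N}{N g(N)}\right)\right)}{g(N)}=1.$$ Let $z_1,z_2,\dots$ be independent random variables with $z_i$ uniformly distributed on $[-g(i),g(i)]$. Then, almost surely, the sequence $(x_n+z_n)_{n\ge1}$ has Poissonian pair correlation.
   Context: $\{x\}$ denotes the fractional part of $x$ and $\|x\|$ the distance from $x$ to the nearest integer. The discrepancy of $(x_n)$ is $D_N=\sup_{0\le a\le b\le 1}\left|\frac{\#\{n\le N:\{x_n\}\in[a,b]\}}{N}-(b-a)\right|$. A real sequence $(y_n)_{n\ge1}$ has Poissonian pair correlation if for every $s>0$, $\lim_{N\to\infty}\frac1N\#\{(m,n): 1\le m\ne n\le N,\ \|y_m-y_n\|<s/N\}=2s$. *)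

(* Defs.v *)
From HB Require Import structures.
From mathcomp Require Import all_boot all_order all_algebra.
From mathcomp Require Import all_classical all_reals all_analysis.
Set Implicit Arguments. Unset Strict Implicit. Unset Printing Implicit Defensive.
Import Order.TTheory GRing.Theory Num.Theory.
Import numFieldNormedType.Exports.
Local Open Scope classical_set_scope.
Local Open Scope ring_scope.

Definition fracp {R : realType} (x : R) : R := x - (Num.floor x)%:~R.

Definition distZ {R : realType} (x : R) : R := Num.min (fracp x) (1 - fracp x).

Definition count_in {R : realType} (x : nat -> R) (N : nat) (a b : R) : nat :=
  \sum_(1 <= n < N.+1) (((a <= fracp (x n)) && (fracp (x n) <= b))%R : nat).

Definition discrepancy {R : realType} (x : nat -> R) (N : nat) : R :=
  sup [set r : R | exists a b : R, [/\ 0 <= a, a <= b, b <= 1 &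
        r = `| (count_in x N a b)%:R / N%:R - (b - a) | ] ].

Definition Mdisc {R : realType} (x : nat -> R) (N : nat) : R :=
  \big[Num.max/0]_(1 <= n < N.+1) (n%:R * discrepancy x n).

Definition pair_count {R : realType} (y : nat -> R) (N : nat) (s : R) : nat :=
  \sum_(1 <= m < N.+1) \sum_(1 <= n < N.+1)
     (((m != n) && (distZ (y m - y n) < s / N%:R))%R : nat).

Definition poissonian_pair_correlation {R : realType} (y : nat -> R) : Prop :=
  forall s : R, 0 < s ->
    (fun N : nat => (pair_count y N s)%:R / N%:R) @ \oo --> 2 * s.

Definition mutually_independent {d} {T : measurableType d} {R : realType}
  (P : probability T R) (z : nat -> T -> R) : Prop :=
  forall (I : seq nat), uniq I -> all (fun i => 0 < i)%N I ->
  forall B : nat -> set R, (forall i, measurable (B i)) ->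
    P (\bigcap_(i in [set` I]) (z i @^-1` B i)) =
    (\prod_(i <- I) P (z i @^-1` B i))%E.

Definition uniform_sym {d} {T : measurableType d} {R : realType}
  (P : probability T R) (X : T -> R) (c : R) : Prop :=
  measurable_fun setT X /\
  forall B : set R, measurable B ->
    P (X @^-1` B) =
    (@lebesgue_measure R (B `&` `[(- c)%R, c]%classic) * ((2 * c)^-1)%:E)%E.

(* Main.v *)
(* Conditionally on [y_m = x_m + z_m], the expected number of [n <= N] with
   [|| y_m - y_n || < s / N] is about [(2 s / N) sum_{n <= N} w_n / (2 g n)], where [w_n]
   counts the integer translates of [y_m] within [g n] of [x_n]. On a block of indices on
   which [g] is nearly constant the discrepancy bound makes [sum w_n / (2 g n)] nearly the
   length of the block; the hypothesis on [g (N + M_N / g N)] forces every block to be much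
   longer than [M / g], so the errors are negligible and the conditional expectation tends
   to [2 s], uniformly in [y_m]. Disjoint pairs are independent and triples contribute
   [O(N)], so the pair count has variance [O(N)]; Chebyshev and Borel-Cantelli along
   [N = j ^ 2] give convergence for rational [s], and monotonicity of the count in [N] and
   [s] does the rest. *)
Require Import Defs.
From HB Require Import structures.
From mathcomp Require Import all_boot all_order all_algebra.
From mathcomp Require Import all_classical all_reals all_analysis.
From mathcomp Require Import measurable_realfun ring lra zify.
Import Order.TTheory GRing.Theory Num.Theory.
Import numFieldNormedType.Exports.
Set Implicit Arguments. Unset Strict Implicit. Unset Printing Implicit Defensive.
Local Open Scope classical_set_scope.
Local Open Scope ring_scope.

(** * Winding numbers and discrepancy *)

Section Discrepancy.
Variable R : realType.
Implicit Types (x : nat -> R) (a b c u v t : R).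

(** Two obstacles shape the proof. The number of blocks is not bounded, so it is not enough that
    each block error is small compared with N: the errors must be charged to lengths. This needs
    blocks of length at least L * M A / g A with L large, while the hypothesis on [g] only controls
    a single step of length M A / g A; that step is iterated with a proportionally smaller loss. The
    last block has no successor to pay for it, and its error is controlled by M N = o(N * g N). This
    is not among the hypotheses: D_N = o(g N) bounds n * D_n only in terms of g n, which may be far
    larger than g N, and the slow drop of [g] closes the gap.

    Conditioning on the continuous variable y_m is done with finite partitions only: the circle is
    cut into [K] short arcs, y_m is replaced by the left end of its arc, and a slight change of s
    absorbs the displacement. *)

Lemma fracp_ge0 t : 0 <= fracp t.
Proof. by rewrite /fracp subr_ge0 floor_le. Qed.

Lemma fracp_lt1 t : fracp t < 1.
Proof.
have := floorD1_gt t; rewrite /fracp intrD.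
lra.
Qed.

(** In this form the triangle inequality and measurability reduce to statements about integer
    translates of an interval. *)
Lemma distZ_ltP t c :
  reflect (exists k : int, `|t - k%:~R| < c) (distZ t < c).
Proof.
have f0 := fracp_ge0 t; have f1 := fracp_lt1 t.
have tE : t = (Num.floor t)%:~R + fracp t by rewrite /fracp; ring.
apply: (iffP idP) => [|[k]].
  rewrite /distZ gt_min => /orP[h|h].
    by exists (Num.floor t); rewrite -/(fracp t) ger0_norm.
  exists (Num.floor t + 1); rewrite intrD opprD addrA -/(fracp t).
  by rewrite ler0_norm; lra.
move=> h; rewrite /distZ gt_min.
have [kt|kt] := leP k (Num.floor t).
  apply/orP; left; move: h; rewrite {1}tE ltr_norml => /andP[_ h].
  have : k%:~R <= (Num.floor t)%:~R :> R by rewrite ler_int.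
  lra.
apply/orP; right; move: h; rewrite {1}tE ltr_norml => /andP[h _].
have : (Num.floor t + 1)%:~R <= k%:~R :> R by rewrite ler_int lezD1.
rewrite intrD; lra.
Qed.

Lemma distZN t : distZ (- t) = distZ t.
Proof.
apply/eqP; rewrite eq_le; apply/andP; split; rewrite leNgt; apply/negP.
  move=> /distZ_ltP[k h]; have : distZ (- t) < distZ (- t); last by rewrite ltxx.
  by apply/distZ_ltP; exists (- k); rewrite intrN opprK -normrN opprD !opprK.
move=> /distZ_ltP[k h]; have : distZ t < distZ t; last by rewrite ltxx.
by apply/distZ_ltP; exists (- k); rewrite intrN opprK -normrN opprD.
Qed.

Lemma distZ_triangle t u (r r' : R) : distZ t < r -> distZ u < r' -> distZ (t + u) < r + r'.
Proof.
move=> /distZ_ltP[k h] /distZ_ltP[l h']; apply/distZ_ltP; exists (k + l).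
rewrite intrD (_ : _ - _ = (t - k%:~R) + (u - l%:~R)); last by ring.
by rewrite (le_lt_trans (ler_normD _ _))// ltrD.
Qed.

(* For [0 <= c], [winding u c] is the number of integers [k] with [`|u + k| <= c]. *)
Definition winding u c : int := Num.floor (c - u) + Num.floor (c + u) + 1.

Lemma winding_ge0 u c : 0 <= c -> 0 <= winding u c.
Proof.
move=> c0; have := floorD1_gt (c - u); have := floorD1_gt (c + u).
rewrite !intrD => h1 h2.
have : (- 2)%:~R < (Num.floor (c - u) + Num.floor (c + u))%:~R :> R.
  rewrite intrD; lra.
rewrite ltr_int /winding; lia.
Qed.

Lemma winding_le u c : (winding u c)%:~R <= 2 * c + 1.
Proof.
have := floor_le (c - u); have := floor_le (c + u).
rewrite /winding !intrD; lra.
Qed.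

Lemma le_winding u c c' : c <= c' -> winding u c <= winding u c'.
Proof.
move=> cc'; rewrite /winding lerD2r lerD//; apply: le_floor; lra.
Qed.

(** Subtracting t from u shifts the two floors by plus and minus the floor of t, up to carries
    decided by the fractional parts. The dependence on t is thus through the indicators of two
    intervals ending at 0 and at 1, which is what the discrepancy controls. *)
Lemma windingE u t c : winding (u - t) c =
  Num.floor (c + u) + Num.floor (c - u)
  + (fracp t <= fracp (c + u))%R%:Z
  + (1 - fracp (c - u) <= fracp t)%R%:Z.
Proof.
pose f := fracp t; have f0 : 0 <= f := fracp_ge0 t; have f1 : f < 1 := fracp_lt1 t.
have tE : t = (Num.floor t)%:~R + f by rewrite /f /fracp; ring.
pose p := fracp (c + u); have p0 : 0 <= p := fracp_ge0 _.
have p1 : p < 1 := fracp_lt1 _.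
have pE : c + u = (Num.floor (c + u))%:~R + p by rewrite /p /fracp; ring.
pose q := fracp (c - u); have q0 : 0 <= q := fracp_ge0 _.
have q1 : q < 1 := fracp_lt1 _.
have qE : c - u = (Num.floor (c - u))%:~R + q by rewrite /q /fracp; ring.
rewrite /winding -/f -/p -/q.
have -> : Num.floor (c - (u - t)) =
    Num.floor (c - u) + Num.floor t + (1 - q <= f)%R%:Z.
  apply: floor_def; rewrite !intrD.
  by case: (leP (1 - q) f) => h; apply/andP; split; rewrite /=; lra.
have -> : Num.floor (c + (u - t)) =
    Num.floor (c + u) - Num.floor t - 1 + (f <= p)%R%:Z.
  apply: floor_def; rewrite !(intrD, intrN).
  by case: (leP f p) => h; apply/andP; split; rewrite /=; lra.
by ring.
Qed.

Lemma count_in_le x N a b : (count_in x N a b <= N)%N.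
Proof.
rewrite /count_in; apply: (@leq_trans (\sum_(1 <= n < N.+1) 1)%N).
  by apply: leq_sum => i _; apply: leq_b1.
by rewrite sum_nat_const_nat subn1 muln1.
Qed.

Lemma discrepancy_ubound x N a b : 0 <= a -> a <= b -> b <= 1 ->
  `| (count_in x N a b)%:R / N%:R - (b - a) | <= discrepancy x N.
Proof.
move=> a0 ab b1; apply: ub_le_sup; last by exists a, b.
exists 1 => _ [a' [b' [a'0 ab' b'1 ->]]].
have h0 : 0 <= (count_in x N a' b')%:R / N%:R :> R by rewrite divr_ge0.
have h1 : (count_in x N a' b')%:R / N%:R <= 1 :> R.
  case: N h0 => [|N] h0; first by rewrite invr0 mulr0.
  by rewrite ler_pdivrMr ?ltr0n// mul1r ler_nat count_in_le.
by rewrite ler_norml; apply/andP; split; lra.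
Qed.

Lemma discrepancy_ge0 x N : 0 <= discrepancy x N.
Proof. exact: le_trans (discrepancy_ubound x N (lexx 0) (ler01) (lexx 1)). Qed.

(** The degenerate interval reduced to the fractional part of x_1 contains at least one point.
    Consequently the discrepancy is positive and [Mdisc] is at least 1. *)
Lemma discrepancy_ge_inv x N : (0 < N)%N -> N%:R^-1 <= discrepancy x N.
Proof.
move=> N0; have f0 := fracp_ge0 (x 1%N); have /ltW f1 := fracp_lt1 (x 1%N).
apply: le_trans (discrepancy_ubound x N f0 (lexx _) f1).
rewrite subrr subr0 ger0_norm ?divr_ge0// -[leLHS]mul1r ler_pM2r ?invr_gt0 ?ltr0n//.
rewrite ler1n /count_in big_nat_recl//= lexx //.
Qed.

Lemma count_in_discrepancy x N a b : 0 <= a -> a <= b -> b <= 1 ->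
  `| (count_in x N a b)%:R - N%:R * (b - a) | <= N%:R * discrepancy x N.
Proof.
case: N => [|N] a0 ab b1.
  by rewrite /count_in big_geq// !mul0r subrr normr0.
have N0 : 0 < N.+1%:R :> R by rewrite ltr0n.
rewrite [X in `|X|](_ : _ =
    N.+1%:R * ((count_in x N.+1 a b)%:R / N.+1%:R - (b - a))); last by field.
by rewrite normrM gtr0_norm// ler_pM2l// discrepancy_ubound.
Qed.

(** By [windingE] the sum is an exact multiple of N plus two interval counts, each off by at most N
    * D_N; hence the factor 2. *)
Lemma sum_winding x N v c :
  `| \sum_(1 <= n < N.+1) (winding (v - x n) c)%:~R - N%:R * (2 * c) |
    <= 2 * (N%:R * discrepancy x N).
Proof.
pose p := fracp (c + v); have p0 : 0 <= p := fracp_ge0 _.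
have p1 : p < 1 := fracp_lt1 _.
pose q := fracp (c - v); have q0 : 0 <= q := fracp_ge0 _.
have q1 : q < 1 := fracp_lt1 _.
have -> : \sum_(1 <= n < N.+1) (winding (v - x n) c)%:~R =
    N%:R * (Num.floor (c + v) + Num.floor (c - v))%:~R
    + (count_in x N 0 p)%:R + (count_in x N (1 - q) 1)%:R :> R.
  under eq_bigr do rewrite windingE 2!intrD.
  rewrite 2!big_split/= /count_in !natr_sum; congr (_ + _ + _).
  - by rewrite sumr_const_nat subn1/= mulr_natl.
  - by apply: eq_bigr => i _; rewrite fracp_ge0.
  - by apply: eq_bigr => i _; rewrite (ltW (fracp_lt1 _)) andbT.
have := count_in_discrepancy x N (lexx 0) p0 (ltW p1).
have q1' : 0 <= 1 - q by lra.
have q2' : 1 - q <= 1 by lra.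
have := count_in_discrepancy x N q1' q2' (lexx 1).
have -> : N%:R * (2 * c) = N%:R * (Num.floor (c + v) + Num.floor (c - v))%:~R
   + N%:R * (p - 0) + N%:R * (1 - (1 - q)) :> R.
  by rewrite intrD /p /q /fracp; ring.
set A := (count_in x N 0 p)%:R; set B := (count_in x N (1 - q) 1)%:R.
move=> h1 h2.
rewrite [X in `|X|](_ : _ = (A - N%:R * (p - 0)) + (B - N%:R * (1 - (1 - q)))); last by ring.
apply: le_trans (ler_normD _ _) _; lra.
Qed.

Lemma Mdisc_ge x N n : (0 < n <= N)%N -> n%:R * discrepancy x n <= Mdisc x N.
Proof.
move=> nN; rewrite /Mdisc.
apply: (le_bigmax_seq 0 n xpredT (fun n : nat => n%:R * discrepancy x n)) => //.
by rewrite mem_index_iota; lia.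
Qed.

Lemma Mdisc_le x N N' : (N <= N')%N -> Mdisc x N <= Mdisc x N'.
Proof. by move=> h; rewrite /Mdisc; apply: le_bigmax_nat. Qed.

Lemma Mdisc_ge1 x N : (0 < N)%N -> 1 <= Mdisc x N.
Proof.
move=> N0; apply: le_trans (Mdisc_ge x (_ : 0 < 1 <= N)%N) => //.
by rewrite mul1r; have := discrepancy_ge_inv x (ltn0Sn 0); rewrite invr1.
Qed.

Lemma Mdisc_attained x N : (0 < N)%N ->
  exists2 n, (0 < n <= N)%N & Mdisc x N = n%:R * discrepancy x n.
Proof.
have MS k : Mdisc x k.+1 = Num.max (Mdisc x k) (k.+1%:R * discrepancy x k.+1).
  have D0 : 0 <= k.+1%:R * discrepancy x k.+1 by rewrite mulr_ge0// discrepancy_ge0.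
  have E : index_iota 1 k.+2 = index_iota 1 k.+1 ++ [:: k.+1].
    by rewrite /index_iota !subSS !subn0 -[in LHS](addn1 k) iotaD add1n.
  rewrite /Mdisc E big_cat_nested/=.
  rewrite big_cons big_nil (max_l D0).
  (* The last term has become the starting value of the fold; the induction moves it outside as an
     outer maximum. *)
  elim: (index_iota 1 k.+1) => [|i s IH]; first by rewrite !big_nil max_r.
  by rewrite !big_cons IH maxA.
elim: N => // -[_ _|N IH _].
  by exists 1%N => //; rewrite MS /Mdisc big_geq// max_r// mulr_ge0// discrepancy_ge0.
have [//|n /andP[n0 nN] e] := IH.
rewrite MS; case: leP => h; first by exists N.+2; rewrite // leqnn.
by exists n => //; rewrite n0 (leq_trans nN).
Qed.

End Discrepancy.

Ltac nat_lia := repeat match goal with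
  | H : is_true (leq _ _) |- _ => move: H
  | H : is_true (andb (leq _ _) (leq _ _)) |- _ => move: H
  | H : @eq nat _ _ |- _ => move: H
  end; clear; intros; lia.

(** * Block decomposition for slowly dropping g *)

Section Growth.
Variables (R : realType) (x : nat -> R) (g : R -> R).
Hypothesis g_pos : forall t : R, 0 < t -> 0 < g t.
Hypothesis g_decr : forall t u : R, 0 < t -> t <= u -> g u <= g t.
Hypothesis hgD : (fun N : nat => g N%:R / discrepancy x N) @ \oo --> +oo.
Hypothesis hNg : (fun N : nat => N%:R * g N%:R) @ \oo --> +oo.
Hypothesis hM : (fun N : nat =>
  g (N%:R * (1 + Mdisc x N / (N%:R * g N%:R))) / g N%:R) @ \oo --> (1 : R).

Local Notation M := (Mdisc x).

Let gn0 (n : nat) : (0 < n)%N -> 0 < g n%:R.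
Proof. by move=> n0; apply: g_pos; rewrite ltr0n. Qed.

Let gle (n m : nat) : (0 < n)%N -> (n <= m)%N -> g m%:R <= g n%:R.
Proof. by move=> n0 nm; apply: g_decr; rewrite ?ltr0n ?ler_nat. Qed.

Lemma exists_nat_gt (t : R) : exists n : nat, t < n%:R.
Proof. by exists (Num.trunc t).+1; rewrite truncnS_gt. Qed.

Lemma eventually_Ng_ge (C : R) :
  exists n0 : nat, forall n, (n0 <= n)%N -> C <= n%:R * g n%:R.
Proof. by case: ((cvgryPge _).1 hNg C) => n0 _ h; exists n0. Qed.

Lemma eventually_discrepancy_le (eps : R) : 0 < eps ->
  exists n0 : nat, forall n, (n0 <= n)%N -> discrepancy x n <= eps * g n%:R.
Proof.
move=> e0; case: ((cvgryPge _).1 hgD eps^-1) => n0 _ h; exists n0.+1 => n nn0.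
have D0 : 0 < discrepancy x n.
  by apply: lt_le_trans (discrepancy_ge_inv x _); rewrite ?invr_gt0 ?ltr0n; nat_lia.
have /= := h n (ltnW nn0).
by rewrite ler_pdivlMr// -ler_pdivlMl ?invr_gt0// invrK.
Qed.

(** The argument of [g] in the hypothesis is n + M n / g n, and monotonicity passes the bound to
    every integer m between n and that point. *)
Lemma eventually_g_step (eta : R) : 0 < eta ->
  exists2 n0 : nat, (0 < n0)%N & forall n m : nat, (n0 <= n <= m)%N ->
    m%:R <= n%:R + M n / g n%:R -> (1 - eta) * g n%:R <= g m%:R.
Proof.
move=> e0; case: ((cvgrPdist_le _ _).1 hM eta e0) => n0 _ h.
exists n0.+1 => // n m /andP[nn0 nm] hm.
have n0' : (0 < n)%N by nat_lia.
have n0R : 0 < n%:R :> R by rewrite ltr0n.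
have g0 := gn0 n0'.
have /= := h n (ltnW nn0).
have -> : n%:R * (1 + Mdisc x n / (n%:R * g n%:R)) = n%:R + M n / g n%:R.
  by field; rewrite !gt_eqF.
rewrite ler_norml => /andP[_ h1].
have {h1} : (1 - eta) <= g (n%:R + M n / g n%:R) / g n%:R by lra.
rewrite ler_pdivlMr// => h1; apply: le_trans h1 _.
by apply: g_decr => //; rewrite ltr0n; nat_lia.
Qed.

Lemma Mdisc_div_le n m : (0 < n)%N -> (n <= m)%N -> M n / g n%:R <= M m / g m%:R.
Proof.
move=> n0 nm; apply: ler_pM.
- by apply: le_trans ler01 _; exact: Mdisc_ge1.
- by rewrite invr_ge0; apply/ltW/gn0.
- exact: Mdisc_le.
- by rewrite lef_pV2 ?posrE ?gn0//; [exact: gle|exact: leq_trans nm].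
Qed.

(** Induction backwards from n: the integer f = floor (Q A) exceeds Q A - 1, hence is at least Q A /
    2 because Q A >= 2, so n - f falls in the range of k steps and one more step leads to n. The
    losses add up by (1 - de) (1 - k de) >= 1 - (k + 1) de. *)
Lemma iterate_step (G Q : nat -> R) (de : R) (A : nat) : 0 < de ->
  (forall n, (A <= n)%N -> 0 <= G n) ->
  (forall n, (A <= n)%N -> G n <= G A) ->
  (forall n, (A <= n)%N -> Q A <= Q n) -> 2 <= Q A ->
  (forall n m : nat, (A <= n)%N -> (n <= m)%N -> m%:R <= n%:R + Q n ->
     (1 - de) * G n <= G m) ->
  forall k n : nat, (A <= n)%N -> n%:R <= A%:R + k%:R * (Q A / 2) ->
    (1 - k%:R * de) * G A <= G n.
Proof.
move=> de0 G0 GA QA q2 step; elim=> [|k IH] n An hn.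
  have -> : n = A.
    by apply/eqP; rewrite eqn_leq An andbT -(ler_nat R); move: hn; rewrite mul0r addr0.
  by rewrite mul0r subr0 mul1r.
have GA0 := G0 A (leqnn A).
have kde : 0 <= k%:R * de by rewrite mulr_ge0// ltW.
move: hn; rewrite -natr1 => hn.
have [h|h] := leP n%:R (A%:R + Q A).
  have := step A n (leqnn A) An h; apply: le_trans.
  rewrite ler_wpM2r//; lra.
have q0 : 0 <= Q A by rewrite (le_trans _ q2).
have := truncn_le (Q A); rewrite q0 => fq.
have := truncnS_gt (Q A); rewrite -natr1 => fq'.
set f := Num.trunc (Q A) in fq fq'.
have fAn : (A + f < n)%N by rewrite -(ltr_nat R) natrD; lra.
have fn : (f <= n)%N by rewrite (leq_trans _ (ltnW fAn))// leq_addl.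
have An' : (A <= n - f)%N by rewrite leq_subRL ?(addnC f) ?(ltnW fAn).
have nfE : (n - f)%:R = n%:R - f%:R :> R by rewrite natrB.
have hn' : (n - f)%:R <= A%:R + k%:R * (Q A / 2) by rewrite nfE; lra.
have IH' := IH _ An' hn'.
have QAn := QA _ An'.
have hs : n%:R <= (n - f)%:R + Q (n - f)%N by rewrite nfE; lra.
have := step _ _ An' (leq_subr _ _) hs; apply: le_trans.
have Gn' := G0 _ An'; have GAn' := GA _ An'.
have [de1|/ltW de1] := leP de 1.
  apply: (@le_trans _ _ ((1 - de) * ((1 - k%:R * de) * G A))).
    rewrite mulrA ler_wpM2r//.
    have : 0 <= de * (k%:R * de) by rewrite mulr_ge0// ltW.
    lra.
  by rewrite ler_wpM2l// subr_ge0.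
(* Here 1 - de is nonpositive, so the upper bound of [G] by [G A] is used in place of the induction
   hypothesis. *)
apply: (@le_trans _ _ ((1 - de) * G A)).
  by rewrite ler_wpM2r//; lra.
by rewrite ler_wnM2l// subr_le0.
Qed.

(* If [g] tends to [0], then [M n / g n >= 2] eventually, so that the step of
   [eventually_g_step] can be iterated on integers at the cost of halving it;
   otherwise [g] has a positive limit and does not drop at all. *)
Lemma eventually_drop_slow (L : nat) (eta : R) : 0 < eta ->
  exists2 n0 : nat, (0 < n0)%N & forall n m : nat, (n0 <= n <= m)%N ->
    g m%:R < (1 - eta) * g n%:R -> L%:R * (M n / g n%:R) <= m%:R - n%:R.
Proof.
move=> eta0.
pose E := [set g n.+1%:R | n in [set: nat]].
have E0 : lbound E 0 by move=> _ [n _ <-]; apply/ltW/gn0.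
have Ei : has_inf E by split; [exists (g 1%:R), 0%N|exists 0].
have [linf|linf] := ltP 0 (inf E).
  have [eta1|eta1] := leP 1 eta.
    exists 1%N => // n m /andP[n0 nm] h.
    by have := gn0 n0; have := gn0 (leq_trans n0 nm); nra.
  (* Past an index where g < (1 + eta) * inf E, a drop by the factor 1 - eta would force (1 - eta)
     (1 + eta) > 1. *)
  have e0 : 0 < inf E * eta by rewrite mulr_gt0.
  have [_ [k _ <-] hk] := inf_adherent e0 Ei.
  exists k.+1 => // n m /andP[kn nm] h.
  have h1 : inf E <= g m%:R.
    apply: ge_inf; first by exists 0.
    by exists m.-1 => //; rewrite prednK//; nat_lia.
  have h2 : g n%:R <= g k.+1%:R by exact: gle.
  nra.
have e0 : 0 < 2^-1 :> R by rewrite invr_gt0.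
have [_ [k _ <-] hk] := inf_adherent e0 Ei.
have {linf E E0 Ei}hk : g k.+1%:R <= 2^-1 by lra.
have [->|L0] := posnP L.
  exists 1%N => // n m /andP[n0 nm] _.
  by rewrite mul0r subr_ge0 ler_nat.
(* 2 L steps of half length cover L * M A / g A; each may lose eta / (2 L). *)
have LR : 0 < (L * 2)%:R :> R by rewrite ltr0n muln_gt0 L0.
have de0 := divr_gt0 eta0 LR.
have [n1 n10 step] := eventually_g_step de0.
exists (maxn n1 k.+1) => [|A n /andP[hA An] hd]; first by rewrite leq_max n10.
have [n1A kA] : (n1 <= A)%N /\ (k < A)%N by move: hA; rewrite geq_max => /andP[].
have A0 : (0 < A)%N by exact: leq_trans n10 n1A.
have gA := gn0 A0.
have q2 : 2 <= M A / g A%:R.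
  rewrite ler_pdivlMr//; have := Mdisc_ge1 x A0.
  have : g A%:R <= g k.+1%:R by exact: gle.
  lra.
rewrite leNgt; apply/negP => hlt.
have : (1 - (L * 2)%:R * (eta / (L * 2)%:R)) * g A%:R <= g n%:R.
  apply: (@iterate_step (fun n => g n%:R) (fun n => M n / g n%:R)) => //.
  - by move=> i Ai; apply/ltW/gn0; exact: leq_trans Ai.
  - by move=> i Ai; exact: gle.
  - by move=> i Ai; exact: Mdisc_div_le.
  - by move=> i m Ai im; apply: step; rewrite (leq_trans n1A Ai).
  - rewrite natrM; lra.
by rewrite mulrCA divff ?mulr1 ?gt_eqF// leNgt hd.
Qed.

(** Let b attain the maximum M N. If g b <= 2 g N, the bound D_b = o(g b) suffices. Otherwise let A
    >= b be the last index before [g] falls below 2 g N. Then M N <= M A, g A < 4 g N, and since [g]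
    halves between A and N, the slow drop gives L * M A / g A <= N - A. *)
Lemma eventually_Mdisc_le (eps : R) : 0 < eps ->
  exists n0 : nat, forall n, (n0 <= n)%N -> M n <= eps * (n%:R * g n%:R).
Proof.
move=> e0.
have [n1 h1] := eventually_discrepancy_le (divr_gt0 e0 (ltr0Sn R 1)).
(* The part g 1 excludes a drop by a quarter in a single step; the part 4 / eps gives the final
   bound. *)
have [L Lgt] := exists_nat_gt (g 1%:R + 4 / eps).
have g1 : 0 < g 1%:R by exact: gn0.
have e4 : 0 < 4 / eps by rewrite divr_gt0.
have e1 : 0 < 4^-1 :> R by lra.
have [n2 n20 drop] := eventually_drop_slow L e1.
have [n3 [n13 n23]] : exists n3, (n1 <= n3 /\ n2 <= n3)%N by exists (n1 + n2)%N; nat_lia.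
(* For b <= n3 the maximum is at most the constant M n3, which N * g N eventually dominates. *)
have [n4 h4] := eventually_Ng_ge (M n3 / eps).
exists (maxn n4 n3) => N hN.
have N0 : (0 < N)%N by nat_lia.
have gN := gn0 N0.
have [b /andP[b0 bN] Mb] := Mdisc_attained x N0;
have [bn3|bn3] := leqP b n3.
  have : M N <= M n3 by rewrite Mb; apply: Mdisc_ge; nat_lia.
  move/le_trans; apply; rewrite mulrC -ler_pdivrMr//; apply: h4; nat_lia.
have Db := h1 b (ltac:(nat_lia)).
have gb := gn0 b0.
have N0R : 0 < N%:R :> R by rewrite ltr0n.
have b0R : 0 < b%:R :> R by rewrite ltr0n.
have bNR : b%:R <= N%:R :> R by rewrite ler_nat.
have [h|h] := leP (g b%:R) (2 * g N%:R).
  rewrite Mb; apply: (@le_trans _ _ (b%:R * (eps * g N%:R))).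
    rewrite ler_pM2l//; apply: le_trans Db _; nra.
  by rewrite mulrCA ler_pM2l// ler_pM2r.
have ex : exists m, (b <= m)%N && (g m%:R < 2 * g N%:R).
  by exists N; rewrite bN; lra.
case: (ex_minnP ex) => m /andP[bm gm] mmin.
have bm' : (b < m)%N.
  by rewrite ltn_neqAle bm andbT; apply/eqP => e; move: gm; rewrite -e; lra.
have [A mA] : exists A, m = A.+1 by exists m.-1; nat_lia.
have bA : (b <= A)%N by nat_lia.
have A0 : (0 < A)%N by nat_lia.
have gA : 2 * g N%:R <= g A%:R.
  rewrite leNgt; apply/negP => hA; have := mmin A; rewrite bA hA/= => /(_ isT); nat_lia.
have mN : (m <= N)%N by apply: mmin; rewrite bN; lra.
have gA0 := gn0 A0.
have MA1 : 1 <= M A by exact: Mdisc_ge1.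
(* A drop by a quarter from A to A + 1 would give L * M A <= g A <= g 1, against M A >= 1 and L > g
   1. *)
have gmA : (1 - 4^-1) * g A%:R <= g m%:R.
  rewrite leNgt; apply/negP => hd.
  have := drop A m (ltac:(nat_lia)) hd.
  rewrite mA -natr1 addrC addKr mulrA ler_pdivrMr// mul1r.
  have : g A%:R <= g 1%:R by apply: gle.
  nra.
have := drop A N (ltac:(nat_lia)) (ltac:(lra)).
rewrite mulrA ler_pdivrMr// => hL.
have MNA : M N <= M A by rewrite Mb; apply: Mdisc_ge; nat_lia.
have : L%:R * M A <= N%:R * (4 * g N%:R).
  apply: le_trans hL _; apply: ler_pM.
  - by rewrite subr_ge0 ler_nat; nat_lia.
  - exact: ltW.
  - by rewrite gerBl.
  - lra.
move=> h5.
have : 4 / eps * M N <= N%:R * (4 * g N%:R).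
  apply: le_trans h5; apply: ler_pM => //; last lra.
  - exact: ltW.
  - by apply: le_trans ler01 _; exact: Mdisc_ge1.
rewrite mulrAC ler_pdivrMr//; lra.
Qed.

(** Difference of the sums up to B - 1 and up to A - 1, each off by at most 2 * M (B - 1). *)
Lemma sum_winding_block (A B : nat) (v c : R) : (0 < A < B)%N ->
  `| \sum_(A <= n < B) (winding (v - x n) c)%:~R - (B%:R - A%:R) * (2 * c) |
    <= 4 * M B.-1.
Proof.
move=> /andP[A0 AB].
have hB := sum_winding x B.-1 v c; have hA := sum_winding x A.-1 v c.
have B0 : (0 < B)%N by nat_lia.
move: hB hA; rewrite !prednK// (@big_cat_nat _ _ _ A 1 B)//=; last exact: ltnW.
set S := \sum_(1 <= _ < A) _; set T := \sum_(A <= _ < B) _.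
have MB : B.-1%:R * discrepancy x B.-1 <= M B.-1 by apply: Mdisc_ge; nat_lia.
have MA : A.-1%:R * discrepancy x A.-1 <= M B.-1.
  have [->|A1] := posnP A.-1.
    by rewrite mul0r; apply: le_trans ler01 _; apply: Mdisc_ge1; nat_lia.
  by apply: Mdisc_ge; nat_lia.
have -> : B%:R - A%:R = B.-1%:R - A.-1%:R :> R.
  rewrite -{1}(prednK B0) -{1}(prednK A0) -!natr1; ring.
set X := B.-1%:R * discrepancy _ _ in MB *.
set Y := A.-1%:R * discrepancy _ _ in MA *.
by rewrite !ler_norml => /andP[? ?] /andP[? ?]; apply/andP; split; lra.
Qed.

(** The shift [sigma] will be plus or minus s / N: it is the enlargement or shrinking of the window
    needed to bound the probability of hitting an arc of that radius. *)
Local Notation wt v sigma n :=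
  ((winding (v - x n) (g n%:R + sigma))%:~R / (2 * g n%:R)).

(** On the block the radius lies between (1 - 2 eta) g A and (1 + eta) g A, and g n between (1 -
    eta) g A and g A. So the weights are squeezed between winding numbers of constant radius over
    constant denominators; (1 + eta) / (1 - eta) - 1 <= 4 eta for eta <= 1/2 gives the constant. *)
Lemma sum_weight_block (A B : nat) (v sigma eta : R) : (0 < A < B)%N ->
  0 < eta <= 2^-1 -> `|sigma| <= eta * g A%:R ->
  (forall n : nat, (A <= n < B)%N -> (1 - eta) * g A%:R <= g n%:R) ->
  (forall n : nat, (A <= n < B)%N -> 0 <= g n%:R + sigma) ->
  `| \sum_(A <= n < B) wt v sigma n - (B%:R - A%:R) |
    <= 4 * eta * (B%:R - A%:R) + 4 * M B.-1 / g A%:R.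
Proof.
move=> AB /andP[eta0 eta1] sig gAB gsig; have /andP[A0 AB'] := AB.
have gA := gn0 A0.
have BA0 : 0 <= B%:R - A%:R :> R by rewrite subr_ge0 ler_nat; nat_lia.
have M0 : 0 <= M B.-1 by apply: le_trans ler01 _; apply: Mdisc_ge1; nat_lia.
move: sig; rewrite ler_norml => /andP[sig1 sig2].
have up : \sum_(A <= n < B) wt v sigma n <=
    (\sum_(A <= n < B) (winding (v - x n) ((1 + eta) * g A%:R))%:~R)
      / (2 * (1 - eta) * g A%:R).
  rewrite mulr_suml big_nat_cond [leRHS]big_nat_cond; apply: ler_sum => n.
  rewrite andbT => hn; have /andP[An _] := hn.
  have gn := gle A0 An; have gn' := gAB n hn; have gn0' := gn0 (leq_trans A0 An).
  rewrite ler_pM//.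
  - by rewrite ler0z winding_ge0// gsig.
  - by rewrite invr_ge0; lra.
  - by rewrite ler_int le_winding//; lra.
  - rewrite lef_pV2 ?posrE; nra.
have lo : (\sum_(A <= n < B) (winding (v - x n) ((1 - 2 * eta) * g A%:R))%:~R)
      / (2 * g A%:R) <= \sum_(A <= n < B) wt v sigma n.
  rewrite mulr_suml big_nat_cond [leRHS]big_nat_cond; apply: ler_sum => n.
  rewrite andbT => hn; have /andP[An _] := hn.
  have gn := gle A0 An; have gn' := gAB n hn; have gn0' := gn0 (leq_trans A0 An).
  apply: (@le_trans _ _ ((winding (v - x n) (g n%:R + sigma))%:~R / (2 * g A%:R))).
    rewrite ler_pM2r ?invr_gt0; last by lra.
    by rewrite ler_int le_winding//; lra.
  rewrite ler_wpM2l//; first by rewrite ler0z winding_ge0// gsig.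
  rewrite lef_pV2 ?posrE; lra.
have := sum_winding_block v ((1 + eta) * g A%:R) AB.
have := sum_winding_block v ((1 - 2 * eta) * g A%:R) AB.
move: up lo; set W := \sum_(A <= n < B) wt v sigma n.
set S1 := \sum_(A <= _ < B) _; set S2 := \sum_(A <= _ < B) _.
rewrite ler_pdivlMr; last by nra.
rewrite ler_pdivrMr; last by nra.
move=> up lo; rewrite !ler_norml => /andP[h1 h2] /andP[h3 h4].
set D := B%:R - A%:R in BA0 h1 h2 h3 h4 *.
pose m := M B.-1 / g A%:R.
have m0 : 0 <= m by rewrite divr_ge0// ltW.
have ME : M B.-1 = m * g A%:R by rewrite /m divfK// gt_eqF.
rewrite -(mulrA 4 (M _)) -/m; rewrite ME in h1 h2 h3 h4.
have U1 : W * (2 * (1 - eta)) <= 2 * (1 + eta) * D + 4 * m.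
  rewrite -(ler_pM2r gA); nra.
have L1 : 2 * (1 - 2 * eta) * D - 4 * m <= W * 2.
  rewrite -(ler_pM2r gA); nra.
apply/andP; split; last first.
  have e1 : 0 < 2 * (1 - eta) by lra.
  rewrite -(ler_pM2r e1) mulrBl.
  have : 2 * (1 + eta) * D + 4 * m - D * (2 * (1 - eta)) <=
     (4 * eta * D + 4 * m) * (2 * (1 - eta)).
    have : 0 <= eta * D * (2^-1 - eta) by rewrite !mulr_ge0//; lra.
    have : 0 <= m * (2^-1 - eta) by apply: mulr_ge0 => //; lra.
    nra.
  lra.
have : 0 <= eta * D by rewrite mulr_ge0// ltW.
lra.
Qed.

(* The greedy blocks end where [g] has dropped by a factor [1 - eta]. The error
   [M B / g A] of a block [A, B) is paid for by the length of the block starting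
   at [B], which is at least [M B / (eta * g B)]; hence the term [M A / g A] on
   the left, which makes the induction work. *)
Lemma sum_weight_chain (n0 L N : nat) (v sigma eta : R) : (0 < n0)%N ->
  0 < eta <= 2^-1 -> eta^-1 <= L%:R -> `|sigma| <= eta * g N%:R ->
  (forall n m : nat, (n0 <= n <= m)%N ->
    g m%:R < (1 - eta) * g n%:R -> L%:R * (M n / g n%:R) <= m%:R - n%:R) ->
  forall A, (n0 <= A <= N)%N ->
  4 * M A / g A%:R + `| \sum_(A <= n < N.+1) wt v sigma n - (N.+1%:R - A%:R) |
    <= 8 * eta * (N.+1%:R - A%:R) + 8 * M N / g N%:R.
Proof.
move=> n00 eta12 hL sig drop A; have /andP[eta0 eta2] := eta12.
have sigle n : (0 < n <= N)%N -> `|sigma| <= eta * g n%:R.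
  move=> /andP[h1 h2]; apply: le_trans sig _; rewrite ler_pM2l//; exact: gle.
have sigge n : (0 < n <= N)%N -> 0 <= g n%:R + sigma.
  move=> h; have := sigle n h; case/andP: h => h _; have := gn0 h.
  rewrite ler_norml => h0 /andP[h1 _]; nra.
have [k] := ubnP (N - A); elim: k A => // k IH A Ak /andP[nA AN].
have A0 : (0 < A)%N by nat_lia.
have gA := gn0 A0.
have N0 : (0 < N)%N by nat_lia.
have gN := gn0 N0.
have [/existsP/=[i /andP[Ai di]]|nd] :=
    boolP [exists i : 'I_N.+1, (A <= i)%N && (g i%:R < (1 - eta) * g A%:R)].
  have ex : exists m, (A <= m)%N && (g m%:R < (1 - eta) * g A%:R).
    by exists i; rewrite Ai.
  case: (ex_minnP ex) => B /andP[AB dB] Bmin.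
  have BN : (B <= N)%N by have := Bmin i; rewrite Ai di => /(_ isT); have := ltn_ord i; nat_lia.
  have AB' : (A < B)%N.
    by rewrite ltn_neqAle AB andbT; apply/eqP => e; move: dB; rewrite -e; nra.
  have B0 : (0 < B)%N by nat_lia.
  have IHB := IH B (ltac:(nat_lia)) (ltac:(nat_lia)).
  have dr := drop A B (ltac:(nat_lia)) dB.
  have bl : `| \sum_(A <= n < B) wt v sigma n - (B%:R - A%:R) |
    <= 4 * eta * (B%:R - A%:R) + 4 * M B.-1 / g A%:R.
    apply: sum_weight_block => //; first by nat_lia.
    - by apply: sigle; nat_lia.
    - move=> n /andP[An nB]; rewrite leNgt; apply/negP => h.
      by have := Bmin n; rewrite An h => /(_ isT); nat_lia.
    - by move=> n /andP[An nB]; apply: sigge; nat_lia.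
  rewrite (@big_cat_nat _ _ _ B A N.+1)//=; last by nat_lia.
  rewrite [X in `|X|](_ : _ =
    (\sum_(A <= n < B) wt v sigma n - (B%:R - A%:R)) +
    (\sum_(B <= n < N.+1) wt v sigma n - (N.+1%:R - B%:R))); last by ring.
  have nD := ler_normD (\sum_(A <= n < B) wt v sigma n - (B%:R - A%:R))
    (\sum_(B <= n < N.+1) wt v sigma n - (N.+1%:R - B%:R)).
  have MBA : M B.-1 / g A%:R <= M B / g B%:R.
    apply: ler_pM.
    - by apply: le_trans ler01 _; apply: Mdisc_ge1; nat_lia.
    - by rewrite invr_ge0 ltW.
    - by apply: Mdisc_le; nat_lia.
    - rewrite lef_pV2 ?posrE ?gn0//; exact: gle.
  (* Half of 8 eta (B - A) pays for the term at A, the other half for the relative error inside the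
     block; the discrepancy error of the block is absorbed by the term at B in the induction
     hypothesis. *)
  have MA : M A / g A%:R <= eta * (B%:R - A%:R).
    rewrite -ler_pdivrMl//; apply: le_trans dr; rewrite ler_wpM2r//.
    by rewrite divr_ge0 ?(ltW gA)//; apply: le_trans ler01 _; exact: Mdisc_ge1.
  rewrite -!mulrA in IHB bl *; lra.
have bl : `| \sum_(A <= n < N.+1) wt v sigma n - (N.+1%:R - A%:R) |
    <= 4 * eta * (N.+1%:R - A%:R) + 4 * M N.+1.-1 / g A%:R.
  apply: sum_weight_block => //; first by nat_lia.
  - by apply: sigle; nat_lia.
  - move=> n /andP[An nN]; rewrite leNgt; apply/negP => h.
    by move/existsP: nd; apply; exists (Ordinal nN); rewrite /= An.
  - by move=> n /andP[An nB]; apply: sigge; nat_lia.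
rewrite /= in bl.
(* In the last block both the term at A and the block error are at most 4 M N / g N, whence the
   8. *)
have h1 := Mdisc_div_le A0 AN.
have h2 : M N / g A%:R <= M N / g N%:R.
  rewrite ler_wpM2l//; first by apply: le_trans ler01 _; exact: Mdisc_ge1.
  by rewrite lef_pV2 ?posrE//; apply: gle.
have h3 : 0 <= eta * (N.+1%:R - A%:R).
  by rewrite mulr_ge0 ?(ltW eta0)// subr_ge0 ler_nat; nat_lia.
rewrite -!mulrA in bl *; lra.
Qed.

(** The chain starts at a fixed [n0]; the indices below it contribute a bounded amount, and 8 M N /
    g N <= 8 eta N closes the chain. *)
Lemma sum_weight (eta : R) : 0 < eta <= 2^-1 ->
  exists N0 : nat, forall N, (N0 <= N)%N -> forall v sigma : R,
    `|sigma| <= eta * g N%:R ->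
    `| \sum_(1 <= n < N.+1) wt v sigma n - N%:R | <= 20 * eta * N%:R.
Proof.
move=> eta12; have /andP[eta0 eta2] := eta12.
have [L /ltW hL] := exists_nat_gt eta^-1.
have [n0 n00 drop] := eventually_drop_slow L eta0.
have [n1 hU] := eventually_Mdisc_le eta0.
have gn00 := gn0 n00.
(* A weight below [n0] is at most 2 + 1 / (2 g n0); the 3 keeps a spare n0 for passing from N + 1 -
   n0 to N. *)
pose C := (3 + (2 * g n0%:R)^-1) * n0%:R.
have C0 : 0 <= C by rewrite mulr_ge0// addr_ge0// invr_ge0; lra.
have [n2 /ltW hn2] := exists_nat_gt (C / eta).
exists (n0 + n1 + n2 + 8)%N => N hN v sigma sig.
have N0 : (0 < N)%N by nat_lia.
have gN := gn0 N0.
have CN : C <= eta * N%:R.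
  rewrite mulrC -ler_pdivrMr//; apply: le_trans hn2 _.
  by rewrite ler_nat; nat_lia.
have := sum_weight_chain v n00 eta12 hL sig drop (A := n0) (ltac:(nat_lia)).
rewrite (@big_cat_nat _ _ _ n0 1 N.+1)//=; last by nat_lia.
set S := \sum_(1 <= _ < n0) _; set W := \sum_(n0 <= _ < N.+1) _ => hW.
have MN : M N / g N%:R <= eta * N%:R by rewrite ler_pdivrMr// -mulrA; apply: hU; nat_lia.
have MA : 0 <= M n0 / g n0%:R.
  by rewrite divr_ge0 ?(ltW gn00)//; apply: le_trans ler01 _; exact: Mdisc_ge1.
have S0 : 0 <= S.
  rewrite /S big_nat_cond; apply: sumr_ge0 => i; rewrite andbT => /andP[i1 i2].
  have gi := gn0 i1; rewrite divr_ge0//; last by lra.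
  have : eta * g N%:R <= eta * g i%:R by rewrite ler_pM2l//; apply: gle => //; nat_lia.
  move: sig; rewrite ler_norml => /andP[s1 s2] s3.
  rewrite ler0z winding_ge0//; nra.
have SC : S <= C - n0%:R.
  apply: (@le_trans _ _ (\sum_(1 <= i < n0) (2 + (2 * g n0%:R)^-1))).
    rewrite /S big_nat_cond [leRHS]big_nat_cond; apply: ler_sum => i.
    rewrite andbT => /andP[i1 i2].
    have gi := gn0 i1.
    have : eta * g N%:R <= eta * g i%:R by rewrite ler_pM2l//; apply: gle => //; nat_lia.
    move: sig; rewrite ler_norml => /andP[s1 s2] s3.
    have gi' : g n0%:R <= g i%:R by apply: gle => //; nat_lia.
    have := winding_le (v - x i) (g i%:R + sigma).
    rewrite ler_pdivrMr; last by lra.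
    move/le_trans; apply.
    have : 1 <= (2 * g n0%:R)^-1 * (2 * g i%:R).
      by rewrite ler_pdivlMl ?mulr1; lra.
    rewrite mulrDl; nra.
  rewrite sumr_const_nat -[leLHS]mulr_natr /C.
  have -> : (3 + (2 * g n0%:R)^-1) * n0%:R - n0%:R = (2 + (2 * g n0%:R)^-1) * n0%:R by ring.
  rewrite ler_wpM2l//; first by rewrite addr_ge0// invr_ge0; lra.
  by rewrite ler_nat; nat_lia.
have n0R : 1 <= n0%:R :> R by rewrite ler1n.
have N8 : 8 <= N%:R :> R by rewrite ler_nat; nat_lia.
have e8 : eta * 8 <= eta * N%:R by rewrite ler_pM2l.
have en : 0 <= eta * n0%:R by rewrite mulr_ge0// ltW.
move: hW; rewrite -[N.+1%:R]natr1 -!mulrA => hW.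
have {hW} : `|W - (N%:R + 1 - n0%:R)| <= 16 * (eta * N%:R) + 8 * eta by lra.
rewrite !ler_norml => /andP[h1 h2]; apply/andP; split; lra.
Qed.

End Growth.

(** * Hitting probabilities of uniform variables *)

Section UniformDistZ.
Variable R : realType.
Local Notation lambda := (@lebesgue_measure R).

Definition distZ_ball (u delta : R) : set R := [set t | distZ (t - u) < delta].

Lemma distZ_ball_bigcup (u delta : R) :
  distZ_ball u delta = \bigcup_(k in [set: int]) ball (u + k%:~R) delta.
Proof.
apply/seteqP; split => t /=.
  by move=> /distZ_ltP[k h]; exists k => //; rewrite /ball/= distrC opprD addrA.
move=> [k _]; rewrite /ball/= distrC opprD addrA => h; apply/distZ_ltP; by exists k.
Qed.

Lemma measurable_distZ_ball (u delta : R) : measurable (distZ_ball u delta).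
Proof.
rewrite distZ_ball_bigcup; apply: open_measurable; apply: bigcup_open => k _.
exact: ball_open.
Qed.

Lemma measurable_fun_distZ_lt d (T : measurableType d) (f : T -> R) (delta : R) :
  measurable_fun setT f -> measurable [set w | distZ (f w) < delta].
Proof.
move=> mf; have -> : [set w | distZ (f w) < delta] = f @^-1` distZ_ball 0 delta.
  by apply/seteqP; split => w; rewrite /distZ_ball/= subr0.
by rewrite -[X in measurable X]setTI; apply: mf => //; exact: measurable_distZ_ball.
Qed.

(** An interval of radius delta around u + k meets [-c, c] only if |u + k| <= c + delta, and
    [winding] counts these k. *)
Lemma lebesgue_distZ_le (u c delta : R) : 0 < c -> 0 < delta ->
  (lambda (distZ_ball u delta `&` `[(- c)%R, c]%classic) <=
    (2 * delta * (winding u (c + delta))%:~R)%:E)%E.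
Proof.
move=> c0 d0.
have w0 : 0 <= winding u (c + delta) by apply: winding_ge0; lra.
(* The smallest k with u + k >= - (c + delta); the relevant k are consecutive from here on. *)
pose k0 : int := - Num.floor (c + delta + u).
pose B i := ball (u + (k0 + i%:Z)%:~R) delta.
have mB i : measurable (B i : set R) by exact: measurable_ball.
have lB i : lambda (B i) = (delta *+ 2)%:E by rewrite /B lebesgue_measure_ball// ltW.
have sub : distZ_ball u delta `&` `[(- c)%R, c]%classic `<=`
    \big[setU/set0]_(i < `|winding u (c + delta)|%N) B i.
  rewrite -bigcup_mkord => t [/distZ_ltP[k]]; rewrite /= in_itv/= => hk /andP[t1 t2].
  move: (hk); rewrite ltr_norml => /andP[h1 h2].
  have k1 : - k <= Num.floor (c + delta + u) by rewrite floor_ge_int intrN; lra.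
  have k2 : k <= Num.floor (c + delta - u) by rewrite floor_ge_int; lra.
  exists `|k - k0|%N; first by rewrite /= /winding /k0; lia.
  have E : k0 + `|k - k0|%N%:Z = k by rewrite /k0; lia.
  by rewrite /B /ball/= E distrC opprD addrA.
apply: (le_trans (le_measure lambda _ _ sub)); rewrite ?inE.
- by apply: measurableI => //; exact: measurable_distZ_ball.
- by apply: bigsetU_measurable => i _; exact: mB.
apply: (le_trans (Boole_inequality lambda _)) => [i _|]; first exact: mB.
rewrite (eq_bigr (fun=> (delta *+ 2)%:E)); last first.
  by move=> i _; exact: lB.
rewrite sumEFin lee_fin big_const_ord iter_addr_0 -(mulr_natr (delta *+ 2)).
have -> : (winding u (c + delta))%:~R = `|winding u (c + delta)|%N%:R :> R.
  by rewrite -[in LHS](gez0_abs w0).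
by rewrite le_eqVlt; apply/orP; left; apply/eqP; ring.
Qed.

(** The intervals with |u + k| <= c - delta lie inside [-c, c], and delta <= 1/2 makes them
    disjoint. *)
Lemma lebesgue_distZ_ge (u c delta : R) : 0 < c -> 0 < delta <= 2^-1 ->
  ((2 * delta * (winding u (c - delta))%:~R)%:E <=
   lambda (distZ_ball u delta `&` `[(- c)%R, c]%classic))%E.
Proof.
move=> c0 /andP[d0 d1].
(* For c < delta the winding formula is no longer a count, but it is then nonpositive and the bound
   is trivial. *)
have [w0|/ltW w0] := leP (winding u (c - delta)) 0.
  apply: (@le_trans _ _ 0%E); last exact: measure_ge0.
  by rewrite lee_fin mulr_ge0_le0 ?lerz0//; lra.
pose k0 : int := - Num.floor (c - delta + u).
pose B i := ball (u + (k0 + i%:Z)%:~R) delta.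
have mB i : measurable (B i : set R) by exact: measurable_ball.
have lB i : lambda (B i) = (delta *+ 2)%:E by rewrite /B lebesgue_measure_ball// ltW.
have sub : \big[setU/set0]_(i < `|winding u (c - delta)|%N) B i `<=`
    distZ_ball u delta `&` `[(- c)%R, c]%classic.
  rewrite -bigcup_mkord => t [i/= iw]; rewrite /B /ball/= => h.
  split; first by apply/distZ_ltP; exists (k0 + i%:Z); rewrite -addrA -opprD distrC.
  have k1 : - (k0 + i%:Z) <= Num.floor (c - delta + u) by rewrite /k0; lia.
  have k2 : k0 + i%:Z <= Num.floor (c - delta - u) by move: iw w0; rewrite /k0 /winding; lia.
  move: k1 k2 h; rewrite !floor_ge_int intrN ltr_norml => k1 k2 /andP[h1 h2].
  rewrite in_itv/=; lra.
apply: (le_trans _ (le_measure lambda _ _ sub)); rewrite ?inE; last 2 first.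
- by apply: bigsetU_measurable => i _; exact: mB.
- by apply: measurableI => //; exact: measurable_distZ_ball.
rewrite measure_semi_additive_ord_I; last 3 first.
- by move=> k _; exact: mB.
- apply/trivIsetP => i j _ _ ij; apply/seteqP; split => // t [].
  rewrite /B /ball/= !ltr_norml => /andP[i1 i2] /andP[j1 j2].
  move: ij; rewrite neq_lt => /orP[] ij.
    have : (k0 + i%:Z + 1)%:~R <= (k0 + j%:Z)%:~R :> R by rewrite ler_int; lia.
    rewrite intrD; lra.
  have : (k0 + j%:Z + 1)%:~R <= (k0 + i%:Z)%:~R :> R by rewrite ler_int; lia.
  rewrite intrD; lra.
- by apply: bigsetU_measurable => i _; exact: mB.
rewrite (eq_bigr (fun=> (delta *+ 2)%:E)); last first.
  by move=> i _; exact: lB.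
rewrite sumEFin lee_fin big_const_ord iter_addr_0 -(mulr_natr (delta *+ 2)).
have -> : (winding u (c - delta))%:~R = `|winding u (c - delta)|%N%:R :> R.
  by rewrite -[in LHS](gez0_abs w0).
by rewrite le_eqVlt; apply/orP; left; apply/eqP; ring.
Qed.

Section Prob.
Context d (T : measurableType d) (P : probability T R) (X : T -> R) (c u delta : R).
Hypotheses (c0 : 0 < c) (hX : uniform_sym P X c).

Let PE : P (X @^-1` distZ_ball u delta) =
  (lambda (distZ_ball u delta `&` `[(- c)%R, c]%classic) * ((2 * c)^-1)%:E)%E.
Proof. by case: hX => _ /(_ _ (measurable_distZ_ball u delta)). Qed.

Lemma uniform_distZ_le : 0 < delta ->
  fine (P (X @^-1` distZ_ball u delta))
    <= 2 * delta * ((winding u (c + delta))%:~R / (2 * c)).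
Proof.
move=> d0; rewrite -lee_fin fineK ?fin_num_measure//; last first.
  by rewrite -[X in measurable X]setTI; apply: hX.1 => //; exact: measurable_distZ_ball.
rewrite PE mulrA EFinM; apply: lee_wpmul2r; last exact: lebesgue_distZ_le.
by rewrite lee_fin invr_ge0 mulr_ge0// ltW.
Qed.

Lemma uniform_distZ_ge : 0 < delta <= 2^-1 ->
  2 * delta * ((winding u (c - delta))%:~R / (2 * c))
    <= fine (P (X @^-1` distZ_ball u delta)).
Proof.
move=> d0; rewrite -lee_fin fineK ?fin_num_measure//; last first.
  by rewrite -[X in measurable X]setTI; apply: hX.1 => //; exact: measurable_distZ_ball.
rewrite PE mulrA EFinM; apply: lee_wpmul2r; last exact: lebesgue_distZ_ge.
by rewrite lee_fin invr_ge0 mulr_ge0// ltW.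
Qed.

End Prob.
End UniformDistZ.

(** * Expected number of points hitting a short arc *)

Section HitProbability.
Variables (R : realType) (x : nat -> R) (g : R -> R).
Hypothesis g_pos : forall t : R, 0 < t -> 0 < g t.
Hypothesis g_decr : forall t u : R, 0 < t -> t <= u -> g u <= g t.
Hypothesis hgD : (fun N : nat => g N%:R / discrepancy x N) @ \oo --> +oo.
Hypothesis hNg : (fun N : nat => N%:R * g N%:R) @ \oo --> +oo.
Hypothesis hM : (fun N : nat =>
  g (N%:R * (1 + Mdisc x N / (N%:R * g N%:R))) / g N%:R) @ \oo --> (1 : R).
Context (d : measure_display) (T : measurableType d) (P : probability T R).
Variable z : nat -> T -> R.
Hypothesis hunif : forall i : nat, (0 < i)%N -> uniform_sym P (z i) (g i%:R).

(** The probability that x_n + z_n comes within delta of v modulo 1; for n different from m it plays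
    the role of the conditional probability given y_m = v. *)
Definition hit n v delta := fine (P (z n @^-1` distZ_ball (v - x n) delta)).

Let gn0 (n : nat) : (0 < n)%N -> 0 < g n%:R.
Proof. by move=> n0; apply: g_pos; rewrite ltr0n. Qed.

(** With delta = s / N the probability is at most 2 delta + 2 delta / g N, which vanishes because N
    * g N tends to infinity. This later removes the diagonal term n = m. *)
Lemma hit_le (s eps : R) : 0 < s -> 0 < eps ->
  exists N0 : nat, forall N m, (N0 <= N)%N -> (0 < m <= N)%N -> forall v,
    hit m v (s / N%:R) <= eps.
Proof.
move=> s0 e0.
have [n1 /ltW h1] := exists_nat_gt (4 * s / eps).
have [n2 /ltW h2] := exists_nat_gt (2 * s).
have [n3 h3] := eventually_Ng_ge hNg (4 * s / eps).
exists (n1 + n2 + n3).+1 => N m hN /andP[m0 mN] v.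
have N0 : 0 < N%:R :> R by rewrite ltr0n; nat_lia.
have gm := gn0 m0.
have gN : 0 < g N%:R by apply: gn0; nat_lia.
have gNm : g N%:R <= g m%:R by apply: g_decr; rewrite ?ltr0n ?ler_nat.
have H1 : 4 * s / eps <= N%:R by apply: le_trans h1 _; rewrite ler_nat; nat_lia.
have H2 : 2 * s <= N%:R by apply: le_trans h2 _; rewrite ler_nat; nat_lia.
have H3 : 4 * s / eps <= N%:R * g N%:R by apply: h3; nat_lia.
have [dl dlE] : exists dl, dl = s / N%:R by exists (s / N%:R).
have d0 : 0 < dl by rewrite dlE divr_gt0.
have d1 : 2 * dl <= 1 by rewrite dlE mulrA ler_pdivrMr// mul1r.
have d2 : 4 * dl <= eps by move: H1; rewrite dlE ler_pdivrMr// mulrA ler_pdivrMr//; lra.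
have d3 : 4 * dl <= eps * g N%:R.
  by rewrite dlE mulrA ler_pdivrMr//; move: H3; rewrite ler_pdivrMr//; lra.
rewrite -dlE; apply: le_trans (uniform_distZ_le (v - x m) gm (hunif m0) d0) _.
have := winding_le (v - x m) (g m%:R + dl).
set w := (winding _ _)%:~R => hw.
rewrite mulrA ler_pdivrMr; last by lra.
apply: (@le_trans _ _ (2 * dl * (2 * (g m%:R + dl) + 1))).
  by rewrite ler_pM2l//; lra.
have d4 : eps * g N%:R <= eps * g m%:R by rewrite ler_pM2l.
have : dl * (2 * dl) <= dl * 1 by rewrite ler_pM2l.
have : (4 * dl) * g m%:R <= eps * g m%:R by rewrite ler_pM2r.
lra.
Qed.

(** The sum lies between 2 delta times the weight sums for [sigma] equal to - delta and delta, where
    delta = s / N; the condition |sigma| <= eta * g N holds because N * g N tends to infinity. *)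
Lemma sum_hit (s eps : R) : 0 < s -> 0 < eps ->
  exists N0 : nat, forall N, (N0 <= N)%N -> forall v,
    `| \sum_(1 <= n < N.+1) hit n v (s / N%:R) - 2 * s | <= eps.
Proof.
move=> s0 e0.
(* The error 20 eta N of the weights times 2 s / N is 40 s eta. *)
have [eta /andP[eta0 eta1] eta2] : exists2 eta, 0 < eta <= 2^-1 & 40 * s * eta <= eps.
  exists (Num.min 2^-1 (eps / (40 * s))).
    by rewrite lt_min ge_min lexx andbT invr_gt0 ltr0n/= divr_gt0// mulr_gt0.
  by rewrite mulrC -ler_pdivlMr ?mulr_gt0// ge_min lexx orbT.
have [n1 h1] := sum_weight g_pos g_decr hgD hNg hM (introT andP (conj eta0 eta1)).
have [n2 /ltW h2] := exists_nat_gt (2 * s).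
have [n3 h3] := eventually_Ng_ge hNg (s / eta).
exists (n1 + n2 + n3).+1 => N hN v.
have N0 : 0 < N%:R :> R by rewrite ltr0n; nat_lia.
have H2 : 2 * s <= N%:R by apply: le_trans h2 _; rewrite ler_nat; nat_lia.
have H3 : s / eta <= N%:R * g N%:R by apply: h3; nat_lia.
have [dl dlE] : exists dl, dl = s / N%:R by exists (s / N%:R).
have d0 : 0 < dl by rewrite dlE divr_gt0.
have d1 : 2 * dl <= 1 by rewrite dlE mulrA ler_pdivrMr// mul1r.
have d2 : dl <= eta * g N%:R.
  by rewrite dlE ler_pdivrMr//; move: H3; rewrite ler_pdivrMr//; lra.
have dN : dl * N%:R = s by rewrite dlE divfK// gt_eqF.
have sg1 : `|dl| <= eta * g N%:R by rewrite gtr0_norm.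
have sg2 : `|- dl| <= eta * g N%:R by rewrite normrN gtr0_norm.
have n1N : (n1 <= N)%N by nat_lia.
have := h1 N n1N v _ sg1; have := h1 N n1N v _ sg2.
set W1 := \sum_(1 <= _ < _) _; set W2 := \sum_(1 <= _ < _) _.
move=> hW1 hW2; rewrite -dlE.
have up : \sum_(1 <= n < N.+1) hit n v dl <= 2 * dl * W2.
  rewrite mulr_sumr big_nat_cond [leRHS]big_nat_cond; apply: ler_sum => n.
  rewrite andbT => /andP[n0 nN].
  exact: uniform_distZ_le (gn0 n0) (hunif n0) d0.
have lo : 2 * dl * W1 <= \sum_(1 <= n < N.+1) hit n v dl.
  rewrite mulr_sumr big_nat_cond [leRHS]big_nat_cond; apply: ler_sum => n.
  rewrite andbT => /andP[n0 nN].
  apply: uniform_distZ_ge (gn0 n0) (hunif n0) _.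
  by rewrite d0; lra.
move: hW1 hW2; rewrite !ler_norml => /andP[a1 _] /andP[_ b2].
have A1 : 2 * dl * (N%:R - 20 * eta * N%:R) <= 2 * dl * W1.
  by rewrite ler_pM2l; lra.
have B2 : 2 * dl * W2 <= 2 * dl * (N%:R + 20 * eta * N%:R).
  by rewrite ler_pM2l; lra.
have E1 : 2 * dl * (N%:R - 20 * eta * N%:R) = 2 * s - 40 * s * eta by rewrite -dN; ring.
have E2 : 2 * dl * (N%:R + 20 * eta * N%:R) = 2 * s + 40 * s * eta by rewrite -dN; ring.
rewrite E1 in A1; rewrite E2 in B2.
apply/andP; split; lra.
Qed.

End HitProbability.

(** * Second moments and independence *)

Section FiniteProbability.
Context d (T : measurableType d) (R : realType) (P : probability T R).
Implicit Types (A B E F : set T) (h : T -> R).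

Definition pr A : R := fine (P A).

Lemma prE A : measurable A -> P A = (pr A)%:E.
Proof. by move=> mA; rewrite /pr fineK// fin_num_measure. Qed.

Lemma pr_ge0 A : 0 <= pr A.
Proof. exact: fine_ge0. Qed.

Lemma le_pr A B : measurable A -> measurable B -> A `<=` B -> pr A <= pr B.
Proof.
move=> mA mB AB; rewrite -lee_fin -!prE//; apply: le_measure => //; by rewrite inE.
Qed.

Lemma prT : pr setT = 1.
Proof. by rewrite /pr probability_setT. Qed.

Lemma pr_partition (K : nat) (f : T -> nat) A : measurable A ->
  (forall j, measurable (f @^-1` [set j])) -> (forall w, (f w < K)%N) ->
  pr A = \sum_(j < K) pr (A `&` f @^-1` [set nat_of_ord j]).
Proof.
move=> mA mf fK; apply: EFin_inj; rewrite -prE// -sumEFin.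
have mI j : measurable (A `&` f @^-1` [set j]) by exact: measurableI.
rewrite (eq_bigr (fun j : 'I_K => P (A `&` f @^-1` [set nat_of_ord j]))); last first.
  by move=> j _; rewrite prE.
pose F j := A `&` f @^-1` [set j].
have AE : A = \big[setU/set0]_(j < K) F j.
  rewrite -bigcup_mkord; apply/seteqP; split => w.
    by move=> Aw; exists (f w) => //=; exact: fK.
  by move=> [j _ []].
rewrite [in LHS]AE; apply: (measure_semi_additive_ord_I P (F := F)).
- by move=> k _; exact: mI.
- apply/trivIsetP => i j _ _ /eqP ij; apply/seteqP; split => // w.
  by move=> [[_ /= ei] [_ /= ej]]; case: ij; rewrite -ei -ej.
- by apply: bigsetU_measurable => i _; exact: mI.
Qed.

(** Integrability travels with the value, so that linearity of the integral applies at every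
    step. *)
Definition has_mean h (a : R) :=
  P.-integrable setT (EFin \o h) /\ (\int[P]_w (h w)%:E = a%:E)%E.

Lemma has_mean_indic A : measurable A -> has_mean (\1_A) (pr A).
Proof.
move=> mA; split; first exact: integrable_indic.
by rewrite integral_indic// setIT; exact: prE.
Qed.

Lemma has_meanD h h' a a' : has_mean h a -> has_mean h' a' ->
  has_mean (fun w => h w + h' w) (a + a').
Proof.
move=> [h1 h2] [h1' h2']; split.
  have -> : EFin \o (fun w => h w + h' w) = (EFin \o h) \+ (EFin \o h') by [].
  exact: integrableD.
under eq_integral do rewrite EFinD.
by rewrite integralD// h2 h2'.
Qed.

Lemma has_meanZ k h a : has_mean h a -> has_mean (fun w => k * h w) (k * a).
Proof.
move=> [h1 h2]; split; first exact: (integrableZl _ k h1).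
under eq_integral do rewrite EFinM.
by rewrite integralZl// h2.
Qed.

Lemma has_mean_cst k : has_mean (fun=> k) k.
Proof.
have := has_meanZ k (has_mean_indic (@measurableT _ T)).
by rewrite prT mulr1; congr has_mean; apply/funext => w; rewrite indicT mulr1.
Qed.

Lemma has_mean_sum (I : Type) (r : seq I) (h : I -> T -> R) (a : I -> R) :
  (forall i, has_mean (h i) (a i)) ->
  has_mean (fun w => \sum_(i <- r) h i w) (\sum_(i <- r) a i).
Proof.
move=> ha; elim: r => [|i r IH].
  rewrite big_nil (_ : (fun _ => _) = fun=> 0); first exact: has_mean_cst.
  by apply/funext => w; rewrite big_nil.
rewrite big_cons (_ : (fun _ => _) = fun w => h i w + \sum_(i <- r) h i w).
  exact: has_meanD.
by apply/funext => w; rewrite big_cons.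
Qed.

Lemma has_mean_ge0 h a : (forall w, 0 <= h w) -> has_mean h a -> 0 <= a.
Proof.
move=> h0 [_ ha]; rewrite -lee_fin -ha; apply: integral_ge0 => w _.
by rewrite lee_fin.
Qed.

(** Chebyshev: the squared deviation minus t^2 times the indicator of [B] is pointwise nonnegative,
    and the mean of the squared deviation is the sum of all covariances. *)
Lemma second_moment_bound (I : Type) (r : seq I) (E : I -> set T) (t : R) :
  (forall i, measurable (E i)) -> 0 < t ->
  let B := [set w | t <= `|\sum_(i <- r) \1_(E i) w - \sum_(i <- r) pr (E i)| ] in
  measurable B ->
  t ^+ 2 * pr B <=
    \sum_(i <- r) \sum_(j <- r) (pr (E i `&` E j) - pr (E i) * pr (E j)).
Proof.
move=> mE t0 B mB.
(* The product of two centred indicators, expanded into terms of known mean. *)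
pose h i j w := \1_(E i `&` E j) w + (- pr (E i) * \1_(E j) w
  + (- pr (E j) * \1_(E i) w + pr (E i) * pr (E j))).
pose a i j := pr (E i `&` E j) - pr (E i) * pr (E j).
have hm i j : has_mean (h i j) (a i j).
  have -> : a i j = pr (E i `&` E j) + (- pr (E i) * pr (E j)
     + (- pr (E j) * pr (E i) + pr (E i) * pr (E j))) by rewrite /a; ring.
  apply: has_meanD; first by apply: has_mean_indic; exact: measurableI.
  apply: has_meanD; first by apply: has_meanZ; exact: has_mean_indic.
  apply: has_meanD; first by apply: has_meanZ; exact: has_mean_indic.
  exact: has_mean_cst.
have hs := has_mean_sum r (fun i => has_mean_sum r (hm i)).
have hB := has_meanZ (- t ^+ 2) (has_mean_indic mB).
rewrite -subr_ge0 -mulNr; apply: has_mean_ge0 (has_meanD hs hB) => w.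
have -> : \sum_(i <- r) \sum_(j <- r) h i j w =
    (\sum_(i <- r) \1_(E i) w - \sum_(i <- r) pr (E i)) ^+ 2.
  have -> : \sum_(i <- r) \1_(E i) w - \sum_(i <- r) pr (E i) =
      \sum_(i <- r) (\1_(E i) w - pr (E i)) by rewrite sumrB.
  rewrite expr2 mulr_suml; apply: eq_bigr => i _.
  rewrite mulr_sumr; apply: eq_bigr => j _.
  by rewrite /h indicI/=; ring.
rewrite mulNr subr_ge0 indicE; case: (boolP (w \in B)) => [|_].
  rewrite inE => h1; rewrite mulr1 -[leRHS]real_normK ?num_real//.
  by rewrite ler_sqr// nnegrE// ltW.
by rewrite mulr0 sqr_ge0.
Qed.

(** The restriction of P to [F] and the multiple of P by the probability of [F] are finite measures
    that agree on the pi-system [G], hence on the sigma-algebra it generates. *)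
Lemma indep_sigma_algebra (G : set (set T)) F : G `<=` measurable ->
  setI_closed G -> G setT -> measurable F ->
  (forall A, G A -> pr (A `&` F) = pr A * pr F) ->
  forall E, <<s G >> E -> pr (E `&` F) = pr E * pr F.
Proof.
move=> mG GI GT mF GF E sE.
have mE : measurable E by move: E sE; apply: smallest_sub => //; exact: sigma_algebra_measurable.
apply: EFin_inj; rewrite EFinM -!prE//; last exact: measurableI.
pose c : {nonneg R} := NngNum (pr_ge0 F).
suff : mrestr P mF E = mscale c P E by rewrite /mrestr/mscale/= => ->; rewrite muleC (prE mF).
apply: (g_sigma_algebra_measure_unique G mG (fun=> setT)) => //.
- by apply/seteqP; split => // w _; exists 0%N.
- move=> A GA; have mA := mG _ GA.
  rewrite -[RHS]/((pr F)%:E * P A)%E (prE mA) -EFinM mulrC -GF// /mrestr.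
  by apply: prE; exact: measurableI.
- by move=> k; change (P (setT `&` F) < +oo)%E; rewrite setTI (prE mF) ltry.
Qed.

End FiniteProbability.

(** * Pair events *)

Section Cells.
Variables (R : realType) (K : nat).
Hypothesis K0 : (0 < K)%N.

Let KR : 0 < K%:R :> R. Proof. by rewrite ltr0n. Qed.

(** The circle is cut into [K] arcs of length 1 / K, so that conditioning on y_m becomes a finite
    partition. *)
Definition cell (t : R) : nat := Num.trunc (K%:R * fracp t).

Let Kf0 (t : R) : 0 <= K%:R * fracp t.
Proof. by rewrite mulr_ge0// fracp_ge0. Qed.

Lemma cell_lt (t : R) : (cell t < K)%N.
Proof.
rewrite -(ltr_nat R); apply: le_lt_trans (_ : K%:R * fracp t < _).
  by rewrite truncn_le.
by rewrite gtr_pMr// fracp_lt1.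
Qed.

Lemma distZ_cell (t : R) : distZ (t - (cell t)%:R / K%:R) < 2 / K%:R.
Proof.
have := truncn_le (K%:R * fracp t); rewrite Kf0 => h1.
have := truncnS_gt (K%:R * fracp t); rewrite -natr1 => h2.
apply/distZ_ltP; exists (Num.floor t).
rewrite (_ : _ - _ = (K%:R * fracp t - (cell t)%:R) / K%:R); last first.
  by rewrite mulrBl mulrAC divff ?gt_eqF// mul1r /fracp; ring.
rewrite normrM [X in _ * X]gtr0_norm ?invr_gt0// ltr_pM2r ?invr_gt0//.
by rewrite ltr_norml /cell; lra.
Qed.

Lemma measurable_cell (j : nat) : measurable [set t : R | cell t = j].
Proof.
have [jK|jK] := ltnP j K; last first.
  rewrite (_ : [set _ | _] = set0)//; apply/seteqP; split => // t /= e.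
  by move: jK; rewrite -e leqNgt cell_lt.
have -> : [set t : R | cell t = j] = \bigcup_(k in [set: int])
    `[k%:~R + j%:R / K%:R, k%:~R + j.+1%:R / K%:R[%classic.
  apply/seteqP; split => t /=.
    move=> <-; exists (Num.floor t) => //=; rewrite in_itv/=.
    have := truncn_le (K%:R * fracp t); rewrite Kf0 => h1.
    have := truncnS_gt (K%:R * fracp t) => h2.
    rewrite -lerBrDl -ltrBlDl -/(fracp t) ler_pdivrMr// ltr_pdivlMr//.
    by rewrite (mulrC _ K%:R) h1 h2.
  move=> [k _]; rewrite /= in_itv/= => /andP[h1 h2].
  have j0 : 0 <= j%:R / K%:R :> R by rewrite divr_ge0.
  have j1 : j.+1%:R / K%:R <= 1 :> R by rewrite ler_pdivrMr// mul1r ler_nat.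
  have fE : Num.floor t = k.
    by apply: floor_def; rewrite intrD; apply/andP; split; lra.
  rewrite /cell /fracp fE; apply: truncn_def.
  by rewrite mulrC -ler_pdivrMr// -ltr_pdivlMr//; apply/andP; split; lra.
by apply: countable_bigcupT_measurable => [|k]; first exact: countableP;  exact: measurable_itv.
Qed.

End Cells.

Section PairEvents.
Context (R : realType) (d : measure_display) (T : measurableType d) (P : probability T R).
Variables (x : nat -> R) (z : nat -> T -> R).
Hypothesis mz : forall i : nat, (0 < i)%N -> measurable_fun setT (z i).
Hypothesis hind : mutually_independent P z.

Local Notation pr := (pr P).
Local Notation y n w := (x n + z n w).
Local Notation hit := (hit x P z).

Definition pair_event (delta : R) m n := [set w | distZ (y m w - y n w) < delta].

Lemma measurable_pair_event delta m n : (0 < m)%N -> (0 < n)%N ->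
  measurable (pair_event delta m n).
Proof.
move=> m0 n0; apply: measurable_fun_distZ_lt; apply: measurable_funB.
  by apply: measurable_funD => //; exact: mz.
by apply: measurable_funD => //; exact: mz.
Qed.

Lemma pair_eventC delta m n : pair_event delta m n = pair_event delta n m.
Proof. by apply/seteqP; split => w; rewrite /pair_event/= -distZN opprB. Qed.

Lemma measurable_preimage n (A : set R) : (0 < n)%N -> measurable A ->
  measurable (z n @^-1` A).
Proof. by move=> n0 mA; rewrite -[X in measurable X]setTI; exact: mz. Qed.

Lemma pr_bigcap (I : seq nat) (B : nat -> set R) : uniq I ->
  all (fun i => 0 < i)%N I -> (forall i, measurable (B i)) ->
  pr (\bigcap_(i in [set` I]) (z i @^-1` B i)) = \prod_(i <- I) pr (z i @^-1` B i).
Proof.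
move=> uI I0 mB; rewrite /pr hind// -[RHS]/(fine (_%:E)); congr fine.
elim: I I0 {uI} => [_|i I IH /=/andP[i0 I0]]; first by rewrite !big_nil.
rewrite !big_cons IH// EFinM; congr (_ * _)%E.
by apply: prE; exact: measurable_preimage.
Qed.

Lemma indep4 a b c e (A B C E : set R) : (0 < a)%N -> (0 < b)%N -> (0 < c)%N ->
  (0 < e)%N -> uniq [:: a; b; c; e] ->
  measurable A -> measurable B -> measurable C -> measurable E ->
  pr ((z a @^-1` A `&` z b @^-1` B) `&` (z c @^-1` C `&` z e @^-1` E)) =
  pr (z a @^-1` A `&` z b @^-1` B) * pr (z c @^-1` C `&` z e @^-1` E).
Proof.
move=> a0 b0 c0 e0 u mA mB mC mE.
pose F i := if i == a then A else if i == b then B else if i == c then C else E.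
have mF i : measurable (F i) by rewrite /F; repeat case: ifP => // _.
have u' := u; move: u; rewrite /= !inE !negb_or !andbT -!andbA.
move=> /and5P[ab ac ae bc /andP[be ce]].
have Fa : F a = A by rewrite /F eqxx.
have Fb : F b = B by rewrite /F eqxx eq_sym (negbTE ab).
have Fc : F c = C by rewrite /F eqxx (eq_sym c a) (negbTE ac) (eq_sym c b) (negbTE bc).
have Fe : F e = E.
  by rewrite /F (eq_sym e a) (negbTE ae) (eq_sym e b) (negbTE be) (eq_sym e c) (negbTE ce).
have h2 i j : i != j -> (0 < i)%N -> (0 < j)%N ->
    pr (z i @^-1` F i `&` z j @^-1` F j) = pr (z i @^-1` F i) * pr (z j @^-1` F j).
  move=> ij i0 j0; have := @pr_bigcap [:: i; j] F.
  rewrite /= inE ij i0 j0 !big_cons big_nil mulr1 => <- //; congr pr.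
  apply/seteqP; split => w.
    by move=> [wi wj] k; rewrite /= !inE => /orP[]/eqP ->.
  by move=> h; split; apply: h; rewrite /= !inE eqxx ?orbT.
have := @pr_bigcap [:: a; b; c; e] F u'.
rewrite /= a0 b0 c0 e0 !big_cons big_nil mulr1 mulrA => /(_ isT mF).
rewrite -!h2// Fa Fb Fc Fe => <-; congr pr.
apply/seteqP; split => w.
  move=> [[wa wb] [wc we]] k; rewrite /= !inE.
  by move=> /or4P[]/eqP ->; rewrite ?Fa ?Fb ?Fc ?Fe.
by move=> h; (split; split); [rewrite -Fa|rewrite -Fb|rewrite -Fc|rewrite -Fe];
  apply: h; rewrite /= !inE eqxx ?orbT.
Qed.

Lemma indep3 a b c (A B C : set R) : (0 < a)%N -> (0 < b)%N -> (0 < c)%N ->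
  uniq [:: a; b; c] -> measurable A -> measurable B -> measurable C ->
  pr (z a @^-1` A `&` (z b @^-1` B `&` z c @^-1` C)) =
  pr (z a @^-1` A) * (pr (z b @^-1` B) * pr (z c @^-1` C)).
Proof.
move=> a0 b0 c0 u mA mB mC.
pose F i := if i == a then A else if i == b then B else C.
have mF i : measurable (F i) by rewrite /F; repeat case: ifP => // _.
have u' := u; move: u; rewrite /= !inE !negb_or !andbT -!andbA => /and3P[ab ac bc].
have Fa : F a = A by rewrite /F eqxx.
have Fb : F b = B by rewrite /F eqxx eq_sym (negbTE ab).
have Fc : F c = C by rewrite /F (eq_sym c a) (negbTE ac) (eq_sym c b) (negbTE bc).
have := @pr_bigcap [:: a; b; c] F u'.
rewrite /= a0 b0 c0 !big_cons big_nil mulr1 => /(_ isT mF).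
rewrite Fa Fb Fc => <-; congr pr; apply/seteqP; split => w.
  move=> [wa [wb wc]] k; rewrite /= !inE.
  by move=> /or3P[]/eqP ->; rewrite ?Fa ?Fb ?Fc.
by move=> h; split; [|split]; [rewrite -Fa|rewrite -Fb|rewrite -Fc];
  apply: h; rewrite /= !inE eqxx ?orbT.
Qed.

Lemma indep2 a b (A B : set R) : (0 < a)%N -> (0 < b)%N -> a != b ->
  measurable A -> measurable B ->
  pr (z a @^-1` A `&` z b @^-1` B) = pr (z a @^-1` A) * pr (z b @^-1` B).
Proof.
(* A third index distinct from both, whose event is the whole space. *)
move=> a0 b0 ab mA mB; pose c := (a + b).+1.
have := @indep3 a b c A B setT a0 b0 isT _ mA mB measurableT.
rewrite preimage_setT setIT prT mulr1; apply.
by rewrite /= !inE negb_or ab /c !andbT /=; apply/andP; split; apply/eqP; nat_lia.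
Qed.

(** A pi-system generating the sigma-algebra of the pair (z_a, z_b). *)
Definition rectangles a b :=
  [set z a @^-1` A `&` z b @^-1` B | A in @measurable _ R & B in @measurable _ R].

(** On the sample space re-equipped with the generated sigma-algebra, z_a and z_b are still
    measurable, hence so is the event. *)
Lemma sigma_pair_event delta a b : <<s rectangles a b >> (pair_event delta a b).
Proof.
pose T' := g_sigma_algebraType (rectangles a b).
have ma : measurable_fun (T := T') setT (z a).
  move=> _ A mA; rewrite setTI; apply: sub_sigma_algebra; exists A => //.
  by exists setT => //; rewrite preimage_setT setIT.
have mb : measurable_fun (T := T') setT (z b).
  move=> _ A mA; rewrite setTI; apply: sub_sigma_algebra; exists setT => //.
  by exists A => //; rewrite preimage_setT setTI.
apply: (@measurable_fun_distZ_lt R _ T' (fun w => y a w - y b w)).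
by apply: measurable_funB; apply: measurable_funD.
Qed.

Lemma rectangles_measurable a b : (0 < a)%N -> (0 < b)%N ->
  rectangles a b `<=` measurable.
Proof.
move=> a0 b0 _ [A mA [B mB <-]]; apply: measurableI; exact: measurable_preimage.
Qed.

Lemma rectangles_setI a b : setI_closed (rectangles a b).
Proof.
move=> _ _ [A mA [B mB <-]] [A' mA' [B' mB' <-]].
exists (A `&` A'); first exact: measurableI.
exists (B `&` B'); first exact: measurableI.
by rewrite !preimage_setI setIACA.
Qed.

Lemma rectangles_setT a b : rectangles a b setT.
Proof. by exists setT => //; exists setT => //; rewrite !preimage_setT setIT. Qed.

(** Independence is extended from rectangles one factor at a time: on the pair (a, b) with the other
    event fixed, then on (c, e) with a rectangle fixed. *)
Lemma pair_event_indep delta a b c e : (0 < a)%N -> (0 < b)%N -> (0 < c)%N ->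
  (0 < e)%N -> uniq [:: a; b; c; e] ->
  pr (pair_event delta a b `&` pair_event delta c e) =
  pr (pair_event delta a b) * pr (pair_event delta c e).
Proof.
move=> a0 b0 c0 e0 u.
apply: (indep_sigma_algebra (rectangles_measurable a0 b0) (@rectangles_setI a b)
  (@rectangles_setT a b)); [exact: measurable_pair_event| |exact: sigma_pair_event].
move=> F rF; rewrite setIC mulrC.
apply: (indep_sigma_algebra (rectangles_measurable c0 e0) (@rectangles_setI c e)
  (@rectangles_setT c e)); [exact: rectangles_measurable rF| |exact: sigma_pair_event].
move=> G [C mC [E mE <-]]; case: rF => A mA [B mB <-].
by rewrite setIC mulrC indep4.
Qed.

Local Notation cells K m j := ((fun w => cell K (y m w)) @^-1` [set j]).

Lemma cellsE K m j : cells K m j = z m @^-1` [set t : R | cell K (x m + t) = j].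
Proof. by []. Qed.

Let mC K m j : (0 < K)%N -> measurable [set t : R | cell K (x m + t) = j].
Proof.
move=> K0; have mf : measurable_fun setT (fun t : R => x m + t) by apply: measurable_funD.
have := mf measurableT _ (measurable_cell K0 j); by rewrite setTI.
Qed.

Let m_cells K m j : (0 < K)%N -> (0 < m)%N -> measurable (cells K m j).
Proof. by move=> K0 m0; rewrite cellsE; apply: measurable_preimage => //; exact: mC. Qed.

Let m_ball n v delta : (0 < n)%N -> measurable (z n @^-1` distZ_ball (v - x n) delta).
Proof. by move=> n0; apply: measurable_preimage => //; exact: measurable_distZ_ball. Qed.

(** Once y_m is replaced by the left end j / K of its cell, the condition involves z_n alone and is
    independent of the cell of y_m. *)
Lemma pair_event_cell_sub K delta delta' m n j : (0 < K)%N ->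
  delta + 2 / K%:R <= delta' ->
  pair_event delta m n `&` cells K m j `<=`
  cells K m j `&` z n @^-1` distZ_ball (j%:R / K%:R - x n) delta'.
Proof.
move=> K0 dd w [/= h <-]; split => //; rewrite /distZ_ball/=.
apply: lt_le_trans dd; rewrite -distZN.
rewrite (_ : - _ = (y m w - y n w) - (y m w - (cell K (y m w))%:R / K%:R)); last by ring.
apply: distZ_triangle => //; rewrite distZN; exact: distZ_cell.
Qed.

Lemma cell_ball_sub K delta delta' m n j : (0 < K)%N ->
  delta' + 2 / K%:R <= delta ->
  cells K m j `&` z n @^-1` distZ_ball (j%:R / K%:R - x n) delta' `<=`
  pair_event delta m n `&` cells K m j.
Proof.
move=> K0 dd w [/= <- h]; split => //; rewrite /pair_event/=.
apply: lt_le_trans dd; move: h; rewrite /distZ_ball/= => h.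
rewrite (_ : _ - _ = - (z n w - ((cell K (y m w))%:R / K%:R - x n))
  + (y m w - (cell K (y m w))%:R / K%:R)); last by ring.
by apply: distZ_triangle; [rewrite distZN|exact: distZ_cell].
Qed.

Lemma sum_pr_cells K m : (0 < K)%N -> (0 < m)%N ->
  \sum_(j < K) pr (cells K m (nat_of_ord j)) = 1.
Proof.
move=> K0 m0; rewrite -(prT P).
rewrite (@pr_partition _ _ _ P K (fun w => cell K (y m w)) setT)//.
- by apply: eq_bigr => j _; rewrite setTI.
- by move=> j; exact: m_cells.
- by move=> w; exact: cell_lt.
Qed.

Lemma pr_cells K m A : (0 < K)%N -> (0 < m)%N -> measurable A ->
  pr A = \sum_(j < K) pr (A `&` cells K m (nat_of_ord j)).
Proof.
move=> K0 m0 mA; apply: pr_partition => //.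
- by move=> j; exact: m_cells.
- by move=> w; exact: cell_lt.
Qed.

Section Sums.
Variables (N K m : nat) (delta delta' c : R).
Hypotheses (K0 : (0 < K)%N) (mN : (0 < m <= N)%N).

Let m0 : (0 < m)%N. Proof. by case/andP: mN. Qed.

Let hit_ge0 n v del : 0 <= hit n v del. Proof. exact: pr_ge0. Qed.

Let C j := pr (cells K m j).

Let sum_cells (F : nat -> R) (t : R) : (forall j, F j <= t) ->
  \sum_(j < K) C j * F j <= t.
Proof.
move=> Ft; apply: (@le_trans _ _ (\sum_(j < K) C j * t)).
  by apply: ler_sum => j _; rewrite ler_wpM2l// pr_ge0.
by rewrite -mulr_suml sum_pr_cells// mul1r.
Qed.

Let sum_cells_ge (F : nat -> R) (t : R) : (forall j, t <= F j) ->
  t <= \sum_(j < K) C j * F j.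
Proof.
move=> Ft; apply: (@le_trans _ _ (\sum_(j < K) C j * t)).
  by rewrite -mulr_suml sum_pr_cells// mul1r.
by apply: ler_sum => j _; rewrite ler_wpM2l// pr_ge0.
Qed.

(** Split by the cell of y_m: independence turns the sum into an average over the cells of sums of
    [hit] probabilities, each at most c. *)
Lemma sum_pair_event_le : delta + 2 / K%:R <= delta' ->
  (forall v, \sum_(1 <= n < N.+1) hit n v delta' <= c) ->
  \sum_(1 <= n < N.+1 | n != m) pr (pair_event delta m n) <= c.
Proof.
move=> dd hc.
apply: (@le_trans _ _ (\sum_(1 <= n < N.+1 | n != m) \sum_(j < K)
    C j * hit n (j%:R / K%:R) delta')).
  rewrite big_nat_cond [leRHS]big_nat_cond; apply: ler_sum => n /andP[/andP[n0 _] nm].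
  rewrite (pr_cells K0 m0 (measurable_pair_event _ m0 n0)).
  apply: ler_sum => j _.
  rewrite /C cellsE -indep2//; last 3 first.
  - by rewrite eq_sym.
  - exact: mC.
  - exact: measurable_distZ_ball.
  apply: le_pr; last exact: pair_event_cell_sub.
  - by apply: measurableI; [exact: measurable_pair_event|exact: m_cells].
  - by apply: measurableI; [exact: m_cells|exact: m_ball].
rewrite exchange_big/=; under eq_bigr do rewrite -mulr_sumr.
apply: (sum_cells (F := fun j => \sum_(1 <= n < N.+1 | n != m) hit n (j%:R / K%:R) delta')).
move=> j; apply: le_trans (hc (j%:R / K%:R)); rewrite big_mkcond.
by apply: ler_sum => n _; case: ifP.
Qed.

(** The same average from below. The sum of [hit] runs over all n while the pair sum omits n = m,
    which costs e. *)
Lemma sum_pair_event_ge (e : R) : delta' + 2 / K%:R <= delta ->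
  (forall v, c <= \sum_(1 <= n < N.+1) hit n v delta') ->
  (forall v, hit m v delta' <= e) ->
  c - e <= \sum_(1 <= n < N.+1 | n != m) pr (pair_event delta m n).
Proof.
move=> dd hc he.
apply: (@le_trans _ _ (\sum_(1 <= n < N.+1 | n != m) \sum_(j < K)
    C j * hit n (j%:R / K%:R) delta')); last first.
  rewrite big_nat_cond [leRHS]big_nat_cond; apply: ler_sum => n /andP[/andP[n0 _] nm].
  rewrite (pr_cells K0 m0 (measurable_pair_event _ m0 n0)).
  apply: ler_sum => j _.
  rewrite /C cellsE -indep2//; last 3 first.
  - by rewrite eq_sym.
  - exact: mC.
  - exact: measurable_distZ_ball.
  apply: le_pr; last exact: cell_ball_sub.
  - by apply: measurableI; [exact: m_cells|exact: m_ball].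
  - by apply: measurableI; [exact: measurable_pair_event|exact: m_cells].
rewrite exchange_big/=; under eq_bigr do rewrite -mulr_sumr.
apply: (sum_cells_ge (F := fun j => \sum_(1 <= n < N.+1 | n != m) hit n (j%:R / K%:R) delta')).
move=> j; have := hc (j%:R / K%:R); have := he (j%:R / K%:R).
rewrite (bigD1_seq m)/= ?iota_uniq ?mem_index_iota//.
lra.
Qed.

(** Within one cell of y_m the hits of n and p are independent; extending the sum over p to all
    indices makes it factor into two sums, each at most c. *)
Lemma sum_pair_event2_le : delta + 2 / K%:R <= delta' ->
  (forall v, \sum_(1 <= n < N.+1) hit n v delta' <= c) ->
  \sum_(1 <= n < N.+1 | n != m) \sum_(1 <= p < N.+1 | (p != m) && (p != n))
    pr (pair_event delta m n `&` pair_event delta m p) <= c ^+ 2.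
Proof.
move=> dd hc.
have c0 : 0 <= c by apply: le_trans (hc 0); apply: sumr_ge0 => n _.
apply: (@le_trans _ _ (\sum_(1 <= n < N.+1 | n != m) \sum_(1 <= p < N.+1)
   \sum_(j < K) C j * (hit n (j%:R / K%:R) delta' * hit p (j%:R / K%:R) delta'))).
  rewrite big_nat_cond [leRHS]big_nat_cond; apply: ler_sum => n /andP[/andP[n0 _] nm].
  rewrite big_nat_cond [leLHS]big_mkcond [leRHS]big_nat_cond [leRHS]big_mkcond.
  apply: ler_sum => p _; rewrite !andbT.
  case: ifP => [/andP[/andP[p0 pN] /andP[pm pn]]|_]; last first.
    case: ifP => // _; apply: sumr_ge0 => j _.
    by rewrite !mulr_ge0// ?hit_ge0// pr_ge0.
  rewrite p0 pN/=.
  have mE : measurable (pair_event delta m n `&` pair_event delta m p).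
    by apply: measurableI; exact: measurable_pair_event.
  rewrite (pr_cells K0 m0 mE); apply: ler_sum => j _.
  rewrite /C cellsE -indep3//; last 4 first.
  - by rewrite /= !inE negb_or !(eq_sym m) nm pm (eq_sym n) pn.
  - exact: mC.
  - exact: measurable_distZ_ball.
  - exact: measurable_distZ_ball.
  apply: le_pr.
  - by apply: measurableI => //; exact: m_cells.
  - by apply: measurableI; [exact: m_cells|apply: measurableI; exact: m_ball].
  - move=> w [[wn wp] wj]; have := pair_event_cell_sub K0 dd (conj wn wj).
    by have := pair_event_cell_sub K0 dd (conj wp wj) => -[_ ?] [? ?]; split.
under eq_bigr => n _.
  rewrite exchange_big/=.
  under eq_bigr do rewrite -mulr_sumr -mulr_sumr.
  over.
rewrite exchange_big/=; under eq_bigr do rewrite -mulr_sumr.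
apply: (sum_cells (F := fun j => \sum_(1 <= n < N.+1 | n != m)
  (hit n (j%:R / K%:R) delta' * \sum_(1 <= p < N.+1) hit p (j%:R / K%:R) delta'))).
move=> j; rewrite -mulr_suml expr2; apply: ler_pM.
- by apply: sumr_ge0 => n _.
- by apply: sumr_ge0 => n _.
- apply: le_trans (hc (j%:R / K%:R)); rewrite big_mkcond.
  by apply: ler_sum => n _; case: ifP.
- exact: hc.
Qed.

End Sums.
End PairEvents.

(** * Reduction to squares and rational s *)

Section Subsequence.
Variable R : realType.
Implicit Types (y : nat -> R) (s : R).

Lemma le_pair_count y N N' s s' : (N <= N')%N -> s / N%:R <= s' / N'%:R ->
  (pair_count y N s <= pair_count y N' s')%N.
Proof.
move=> NN ss; rewrite /pair_count.
have widen (f f' : nat -> nat) : (forall i, f i <= f' i)%N ->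
    (\sum_(1 <= i < N.+1) f i <= \sum_(1 <= i < N'.+1) f' i)%N.
  move=> ff; rewrite (@big_cat_nat _ _ _ N.+1 1 N'.+1)//=.
  by apply: leq_trans (leq_addr _ _); apply: leq_sum => i _.
apply: (widen _ _) => m; apply: (widen _ _) => n.
case: (m != n) => //=; case: ltP => // h.
by rewrite (lt_le_trans h ss).
Qed.

Lemma exists_ratio_between (a b : R) : 0 <= a -> a < b ->
  exists k l : nat, a < k.+1%:R / l.+1%:R < b.
Proof.
move=> a0 ab; have ba : 0 < b - a by rewrite subr_gt0.
have [l hl] := exists_nat_gt (b - a)^-1.
have l0 : 0 < l.+1%:R :> R by rewrite ltr0n.
have hl' : 1 < (b - a) * l.+1%:R.
  rewrite -ltr_pdivrMl// mulr1 (lt_trans hl)// ltr_nat//.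
exists (Num.trunc (a * l.+1%:R)), l.
have al : 0 <= a * l.+1%:R by rewrite mulr_ge0// ltW.
have := truncn_le (a * l.+1%:R); rewrite al => h1.
have h2 := truncnS_gt (a * l.+1%:R).
rewrite ltr_pdivlMr// ltr_pdivrMr// h2/= -natr1; lra.
Qed.

Lemma square_floor (N : nat) : exists2 j : nat, (j ^ 2 <= N)%N & (N < j.+1 ^ 2)%N.
Proof.
have ex : exists j, (j ^ 2 <= N)%N by exists 0%N.
have ub j : (j ^ 2 <= N)%N -> (j <= N)%N.
  by move=> h; apply: leq_trans h; case: j => // j; rewrite expnS expn1 leq_pmulr.
case: (ex_maxnP ex ub) => j jN jmax; exists j => //.
by rewrite ltnNge; apply/negP => /jmax; rewrite ltnn.
Qed.

(** For j^2 <= N < (j + 1)^2 and ratios s2 < s < s1 close to s, the count at (N, s) lies between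
    those at (j^2, s2) and ((j + 1)^2, s1). *)
Lemma poissonian_of_squares y :
  (forall a b k : nat, exists j0 : nat, forall j : nat, (j0 <= j)%N ->
    `| (pair_count y (j ^ 2) (a.+1%:R / b.+1%:R : R))%:R
        - 2 * (a.+1%:R / b.+1%:R) * (j ^ 2)%:R | <= (j ^ 2)%:R / k.+1%:R :> R) ->
  poissonian_pair_correlation y.
Proof.
move=> H s s0; apply/cvgrPdist_le => eps e0.
have [k hk] := exists_nat_gt (8 / eps).
have [e [e1 e2]] : exists e : R, e = k.+1%:R^-1 /\ e <= eps / 8.
  exists k.+1%:R^-1; split => //; rewrite -[leRHS]invrK lef_pV2 ?posrE ?ltr0n//.
    by rewrite invf_div (le_trans (ltW hk))// ler_nat.
  by rewrite invr_gt0 divr_gt0.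
have slt : s < s + eps / 8 by lra.
have [a1 [b1 hs1]] := exists_ratio_between (ltW s0) slt.
have [j1 h1] := H a1 b1 k.
(* The maximum with 0 keeps the lower ratio positive when s is smaller than eps / 8. *)
have m0 : 0 <= Num.max 0 (s - eps / 8) by rewrite le_max lexx.
have mlt : Num.max 0 (s - eps / 8) < s by rewrite gt_max s0/=; lra.
have [a2 [b2 hs2]] := exists_ratio_between m0 mlt.
have [j2 h2] := H a2 b2 k.
rewrite -e1 in h1 h2.
move: (_ / b1.+1%:R) hs1 h1 (_ / b2.+1%:R) hs2 h2 => s1 /andP[s1s s1e] h1 s2.
rewrite gt_max => /andP[/andP[s20 s2e] s2s] h2.
(* The relative gap allowed between consecutive squares: two conditions order the thresholds, the
   third bounds by eps / 2 the effect of exchanging a square for N. *)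
have [rho [r0 r1 r2 r3]] : exists rho : R, [/\ 0 < rho, rho * s <= s1 - s,
    rho * s2 <= s - s2 & rho * (2 * s + eps / 2) <= eps / 2].
  have p1 : 0 < (s1 - s) / s by apply: divr_gt0; lra.
  have p2 : 0 < (s - s2) / s2 by apply: divr_gt0; lra.
  have p3 : 0 < (eps / 2) / (2 * s + eps / 2) by rewrite divr_gt0//; lra.
  exists (Num.min ((s1 - s) / s) (Num.min ((s - s2) / s2) ((eps / 2) / (2 * s + eps / 2)))).
  split; rewrite ?lt_min ?p1 ?p2 ?p3//.
  - by rewrite -ler_pdivlMr// ge_min lexx.
  - by rewrite -ler_pdivlMr// !ge_min lexx !orbT.
  - by rewrite -ler_pdivlMr ?ge_min ?ge_min ?lexx ?orbT//; lra.
(* Consecutive squares differ by 2 j + 1 <= 3 j <= rho * j^2. *)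
have [J hJ] := exists_nat_gt (3 / rho).
exists ((J + j1 + j2).+1 ^ 2)%N => // N /= hN.
have [j jN Nj] := square_floor N.
have jj : ((J + j1 + j2).+1 <= j)%N.
  by rewrite -ltnS -(ltn_exp2r _ _ (ltn0Sn 1)); exact: leq_ltn_trans hN Nj.
have j0 : 0 < j%:R :> R by rewrite ltr0n; nat_lia.
have j1' : 1 <= j%:R :> R by rewrite ler1n; nat_lia.
have rj : 3 <= rho * j%:R.
  rewrite mulrC -ler_pdivrMr//; apply: le_trans (ltW hJ) _; rewrite ler_nat; nat_lia.
have jNR : j%:R ^+ 2 <= N%:R :> R by rewrite -natrX ler_nat.
have N0 : 0 < N%:R :> R by apply: lt_le_trans jNR; rewrite exprn_gt0.
have NjR : N%:R + 1 <= (j%:R + 1) ^+ 2 :> R.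
  by rewrite !natr1 -natrX ler_nat.
have rj2 : 3 * j%:R <= rho * j%:R ^+ 2 by rewrite expr2 mulrA ler_pM2r.
have up : (j%:R + 1) ^+ 2 <= N%:R * (1 + rho).
  have : rho * j%:R ^+ 2 <= rho * N%:R by rewrite ler_pM2l.
  rewrite sqrrD expr1n mulr1; lra.
have lo : N%:R <= j%:R ^+ 2 * (1 + rho).
  by move: NjR; rewrite sqrrD expr1n mulr1; lra.
have jE : (j.+1 ^ 2)%:R = (j%:R + 1) ^+ 2 :> R by rewrite natrX natr1.
have q0 : 0 < (j%:R + 1) ^+ 2 :> R by rewrite exprn_gt0// addr_gt0.
have p0 : 0 < j%:R ^+ 2 :> R by rewrite exprn_gt0.
have c1 : (pair_count y N s <= pair_count y (j.+1 ^ 2) s1)%N.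
  apply: le_pair_count; first exact: ltnW.
  rewrite jE ler_pdivlMr// mulrAC ler_pdivrMr//.
  apply: (@le_trans _ _ (s * (N%:R * (1 + rho)))); first by rewrite ler_pM2l.
  rewrite mulrCA -[leRHS]mulrC ler_pM2l//; lra.
have c2 : (pair_count y (j ^ 2) s2 <= pair_count y N s)%N.
  apply: le_pair_count => //.
  rewrite natrX ler_pdivlMr// mulrAC ler_pdivrMr//.
  apply: (@le_trans _ _ (s2 * (j%:R ^+ 2 * (1 + rho)))); first by rewrite ler_pM2l.
  rewrite mulrCA -[leRHS]mulrC ler_pM2l//; lra.
have H1 := h1 j.+1 (ltac:(nat_lia)); have H2 := h2 j (ltac:(nat_lia)).
rewrite jE ler_norml in H1; rewrite natrX ler_norml in H2.
have {H1 H2}[/andP[_ H1] /andP[H2 _]] := (H1, H2).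
have C1 : (pair_count y N s)%:R <= (pair_count y (j.+1 ^ 2) s1)%:R :> R by rewrite ler_nat.
have C2 : (pair_count y (j ^ 2) s2)%:R <= (pair_count y N s)%:R :> R by rewrite ler_nat.
have C0 : 0 <= (pair_count y N s)%:R :> R by [].
set p := (pair_count y N s)%:R in C1 C2 C0 *.
set p1 := (pair_count _ _ s1)%:R in C1 H1.
set p2 := (pair_count _ _ s2)%:R in C2 H2.
set q := (j%:R + 1) ^+ 2 in q0 up H1.
set t := j%:R ^+ 2 in p0 lo jNR H2.
have U : p <= (2 * s + eps) * N%:R.
  apply: (@le_trans _ _ ((2 * s + eps / 2) * q)).
    have : 0 <= (2 * s + eps / 2 - 2 * s1 - e) * q by rewrite mulr_ge0 ?(ltW q0)//; lra.
    lra.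
  have X0 : 0 < 2 * s + eps / 2 by lra.
  apply: (@le_trans _ _ ((2 * s + eps / 2) * (N%:R * (1 + rho)))); first by rewrite ler_pM2l.
  have : (rho * (2 * s + eps / 2)) * N%:R <= eps / 2 * N%:R by rewrite ler_pM2r.
  lra.
have L : (2 * s - eps) * N%:R <= p.
  have Lt : (2 * s - eps / 2) * t <= p.
    have : 0 <= (2 * s2 - e - (2 * s - eps / 2)) * t by rewrite mulr_ge0 ?(ltW p0)//; lra.
    lra.
  have [X0|X0] := leP (2 * s - eps / 2) 0.
    by apply: le_trans C0; rewrite mulr_le0_ge0 ?(ltW N0)//; lra.
  apply: le_trans Lt.
  have : (2 * s - eps / 2) * (N%:R - t) <= (2 * s - eps / 2) * (rho * t).
    by rewrite ler_pM2l//; lra.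
  have : (rho * (2 * s + eps / 2)) * t <= eps / 2 * N%:R.
    by apply: ler_pM => //; rewrite ?mulr_ge0 ?(ltW r0) ?(ltW p0)//; lra.
  have : 0 <= rho * eps * t by rewrite !mulr_ge0// ltW.
  lra.
have U' : p / N%:R <= 2 * s + eps by rewrite ler_pdivrMr.
have L' : 2 * s - eps <= p / N%:R by rewrite ler_pdivlMr.
by rewrite ler_norml; apply/andP; split; lra.
Qed.

End Subsequence.

(** * Sums over ordered pairs of distinct indices *)

Section PairSums.
Variables (R : realType) (I : finType).

Lemma sum_offdiag (W : I -> I -> R) :
  \sum_(p : I * I | p.1 != p.2) W p.1 p.2 = \sum_a \sum_(b | b != a) W a b.
Proof.
rewrite -(pair_big_dep xpredT (fun a b => a != b) (fun a b => W a b))/=.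
by apply: eq_bigr => a _; apply: eq_bigl => b; rewrite eq_sym.
Qed.

Lemma sum_offdiag_swap (W : I -> I -> R) :
  \sum_(p : I * I | p.1 != p.2) W p.2 p.1 = \sum_(p : I * I | p.1 != p.2) W p.1 p.2.
Proof.
rewrite (reindex (fun p : I * I => (p.2, p.1)))/=; last first.
  by exists (fun p : I * I => (p.2, p.1)) => -[].
by apply: eq_bigl => p; rewrite eq_sym.
Qed.

Lemma sum_offdiag_row (a : I) (F : I -> R) :
  \sum_(q : I * I | q.1 != q.2) (q.1 == a)%:R * F q.2 = \sum_(c | c != a) F c.
Proof.
rewrite (sum_offdiag (fun i j => (i == a)%:R * F j)) (bigD1 a)//= eqxx.
rewrite [X in _ + X]big1 ?addr0; first by apply: eq_bigr => c _; rewrite mul1r.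
by move=> i /negbTE ia; apply: big1 => j _; rewrite ia mul0r.
Qed.

Lemma sum_offdiag_col (a : I) (F : I -> R) :
  \sum_(q : I * I | q.1 != q.2) (q.2 == a)%:R * F q.1 = \sum_(c | c != a) F c.
Proof.
by rewrite (sum_offdiag_swap (fun i j => (i == a)%:R * F j)) sum_offdiag_row.
Qed.

(** The four terms are the four ways q can share an index with p; each collapses to a sum over a
    common index a and two partners b and c, where b = c is allowed. *)
Lemma sum_overlap_le (k : I * I -> I * I -> R) (t : I -> I -> I -> R) :
  (forall p q, p.1 != p.2 -> q.1 != q.2 ->
     k p q <= (q.1 == p.1)%:R * t p.1 p.2 q.2 + (q.2 == p.1)%:R * t p.1 p.2 q.1
            + (q.1 == p.2)%:R * t p.2 p.1 q.2 + (q.2 == p.2)%:R * t p.2 p.1 q.1) ->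
  \sum_(p | p.1 != p.2) \sum_(q | q.1 != q.2) k p q
    <= 4 * \sum_a \sum_(b | b != a) \sum_(c | c != a) t a b c.
Proof.
move=> hk.
apply: (@le_trans _ _ (\sum_(p : I * I | p.1 != p.2)
   (2 * (\sum_(c | c != p.1) t p.1 p.2 c) + 2 * (\sum_(c | c != p.2) t p.2 p.1 c)))).
  apply: ler_sum => p pp.
  apply: le_trans (ler_sum _ (fun q qq => hk p q pp qq)) _.
  rewrite !big_split/= !sum_offdiag_row !sum_offdiag_col; lra.
rewrite big_split/= -!mulr_sumr.
rewrite (sum_offdiag_swap (fun a b => \sum_(c | c != a) t a b c)).
rewrite (sum_offdiag (fun a b => \sum_(c | c != a) t a b c)); lra.
Qed.

End PairSums.

(** * Variance of the pair count *)

Section Moments.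
Variables (R : realType) (x : nat -> R) (g : R -> R).
Hypothesis g_pos : forall t : R, 0 < t -> 0 < g t.
Hypothesis g_decr : forall t u : R, 0 < t -> t <= u -> g u <= g t.
Hypothesis hgD : (fun N : nat => g N%:R / discrepancy x N) @ \oo --> +oo.
Hypothesis hNg : (fun N : nat => N%:R * g N%:R) @ \oo --> +oo.
Hypothesis hM : (fun N : nat =>
  g (N%:R * (1 + Mdisc x N / (N%:R * g N%:R))) / g N%:R) @ \oo --> (1 : R).
Context (d : measure_display) (T : measurableType d) (P : probability T R).
Variable z : nat -> T -> R.
Hypothesis hunif : forall i : nat, (0 < i)%N -> uniform_sym P (z i) (g i%:R).
Hypothesis hind : mutually_independent P z.

Local Notation pr := (pr P).
Local Notation pe := (pair_event x z).

Let mz i : (0 < i)%N -> measurable_fun setT (z i).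
Proof. by move=> /hunif[]. Qed.

Let mpe delta m n : (0 < m)%N -> (0 < n)%N -> measurable (pe delta m n).
Proof. exact: measurable_pair_event. Qed.

(** Upper and lower bounds come from the hit sums at s + eta and s - eta, the margin eta absorbing
    the discretisation of y_m. *)
Lemma sum_pair_event (s eps : R) : 0 < s -> 0 < eps ->
  exists N0 : nat, forall N m, (N0 <= N)%N -> (0 < m <= N)%N ->
    `| \sum_(1 <= n < N.+1 | n != m) pr (pe (s / N%:R) m n) - 2 * s | <= eps.
Proof.
move=> s0 e0.
have [eta [eta0 eta1 eta2]] : exists eta, [/\ 0 < eta, 2 * eta <= s & 8 * eta <= eps].
  exists (Num.min (s / 2) (eps / 8)); split.
  - by rewrite lt_min !divr_gt0.
  - by rewrite mulrC -ler_pdivlMr// ge_min lexx.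
  - by rewrite mulrC -ler_pdivlMr// ge_min lexx orbT.
have s1 : 0 < s + eta by lra.
have s2 : 0 < s - eta by lra.
have e4 : 0 < eps / 4 by rewrite divr_gt0.
have [n1 h1] := sum_hit g_pos g_decr hgD hNg hM hunif s1 e4.
have [n2 h2] := sum_hit g_pos g_decr hgD hNg hM hunif s2 e4.
have [n3 h3] := hit_le x g_pos g_decr hNg hunif s2 e4.
exists (n1 + n2 + n3)%N => N m hN mN.
have NR : 0 < N%:R :> R by rewrite ltr0n; case/andP: mN => a b; exact: leq_trans b.
(* The mesh depends on N, so that the displacement 2 / K stays below eta / N. *)
have [K hK] := exists_nat_gt (2 * N%:R / eta).
have K0R : 0 < K%:R :> R by apply: le_lt_trans hK; rewrite divr_ge0 ?mulr_ge0// ltW.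
have K0 : (0 < K)%N by rewrite -(ltr_nat R).
have KN : 2 / K%:R <= eta / N%:R.
  rewrite ler_pdivrMr// mulrAC ler_pdivlMr//.
  by move: hK; rewrite ltr_pdivrMr// [ltRHS]mulrC => /ltW.
have d1 : s / N%:R + 2 / K%:R <= (s + eta) / N%:R by rewrite [leRHS]mulrDl lerD2l.
have d2 : (s - eta) / N%:R + 2 / K%:R <= s / N%:R by rewrite mulrBl; lra.
have h1' v : \sum_(1 <= n < N.+1) hit x P z n v ((s + eta) / N%:R) <= 2 * (s + eta) + eps / 4.
  by have := h1 N (ltac:(nat_lia)) v; rewrite ler_norml => /andP[_]; lra.
have h2' v : 2 * (s - eta) - eps / 4 <= \sum_(1 <= n < N.+1) hit x P z n v ((s - eta) / N%:R).
  by have := h2 N (ltac:(nat_lia)) v; rewrite ler_norml => /andP[+ _]; lra.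
have h3' v : hit x P z m v ((s - eta) / N%:R) <= eps / 4 by apply: h3 => //; nat_lia.
have up := sum_pair_event_le mz hind K0 mN d1 h1'.
have lo := sum_pair_event_ge mz hind K0 mN d2 h2' h3'.
by rewrite ler_norml; apply/andP; split; lra.
Qed.

(** For p distinct from n the bound is the square of the hit sum at 2 s, the doubling making room
    for the discretisation; the terms p = n reduce to single pair events. *)
Lemma sum_pair_event2 (s : R) : 0 < s ->
  exists N0 : nat, exists2 C : R, 0 <= C & forall N m, (N0 <= N)%N -> (0 < m <= N)%N ->
    \sum_(1 <= n < N.+1 | n != m) \sum_(1 <= p < N.+1 | p != m)
      pr (pe (s / N%:R) m n `&` pe (s / N%:R) m p) <= C.
Proof.
move=> s0.
have s2 : 0 < 2 * s by lra.
have [n1 h1] := sum_hit g_pos g_decr hgD hNg hM hunif s2 ltr01.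
have [n2 h2] := sum_pair_event s0 ltr01.
exists (n1 + n2)%N; exists ((2 * (2 * s) + 1) ^+ 2 + (2 * s + 1)).
  by apply: addr_ge0; [exact: sqr_ge0|lra].
move=> N m hN mN; have /andP[m0 _] := mN.
have NR : 0 < N%:R :> R by rewrite ltr0n; case/andP: mN => a b; exact: leq_trans b.
have [K hK] := exists_nat_gt (2 * N%:R / s).
have K0R : 0 < K%:R :> R by apply: le_lt_trans hK; rewrite divr_ge0 ?mulr_ge0// ltW.
have K0 : (0 < K)%N by rewrite -(ltr_nat R).
have KN : 2 / K%:R <= s / N%:R.
  rewrite ler_pdivrMr// mulrAC ler_pdivlMr//.
  by move: hK; rewrite ltr_pdivrMr// [ltRHS]mulrC => /ltW.
have d1 : s / N%:R + 2 / K%:R <= (2 * s) / N%:R by lra.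
have h1' v : \sum_(1 <= n < N.+1) hit x P z n v ((2 * s) / N%:R) <= 2 * (2 * s) + 1.
  by have := h1 N (ltac:(nat_lia)) v; rewrite ler_norml => /andP[_]; lra.
have q := sum_pair_event2_le mz hind K0 mN d1 h1'.
have l : \sum_(1 <= n < N.+1 | n != m) pr (pe (s / N%:R) m n) <= 2 * s + 1.
  by have := h2 N m (ltac:(nat_lia)) mN; rewrite ler_norml => /andP[_]; lra.
apply: le_trans (lerD q l); rewrite -big_split/= big_nat_cond [leRHS]big_nat_cond.
apply: ler_sum => n /andP[nN nm].
rewrite big_mkcond (bigD1_seq n)/= ?iota_uniq ?mem_index_iota//.
rewrite nm.
rewrite setIid addrC -big_mkcondr lerD2r.
by under eq_bigl do rewrite andbC.
Qed.

Definition pair_count_at N s w := pair_count (fun n => x n + z n w) N s.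

Lemma pair_count_atE N s w : (pair_count_at N s w)%:R =
  \sum_(p : 'I_N * 'I_N | p.1 != p.2) \1_(pe (s / N%:R) p.1.+1 p.2.+1) w :> R.
Proof.
rewrite (sum_offdiag (fun a b : 'I_N => \1_(pe (s / N%:R) a.+1 b.+1) w)).
rewrite /pair_count_at /pair_count natr_sum big_add1 big_mkord; apply: eq_bigr => a _.
rewrite natr_sum big_add1 big_mkord [RHS]big_mkcond; apply: eq_bigr => b _.
rewrite eqSS -(inj_eq val_inj) eq_sym; case: (val b != val a) => //=.
rewrite indicE; congr (nat_of_bool _)%:R.
by apply/idP/idP; rewrite inE.
Qed.

Lemma sum_ord_offdiag (N : nat) (m : 'I_N) (F : nat -> R) :
  \sum_(n < N | n != m) F n.+1 = \sum_(1 <= n < N.+1 | n != m.+1) F n.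
Proof. by rewrite big_add1 big_mkord; apply: eq_bigl => n; rewrite eqSS. Qed.

(** For overlapping pairs the covariance is at most the probability of the intersection, and
    symmetry of pair events brings the shared index to the front. Each shared index then contributes
    at most 4 C. *)
Lemma pair_event_variance (s : R) : 0 < s ->
  exists N0 : nat, exists2 C : R, 0 <= C & forall N, (N0 <= N)%N ->
    \sum_(p : 'I_N * 'I_N | p.1 != p.2) \sum_(q : 'I_N * 'I_N | q.1 != q.2)
      (pr (pe (s / N%:R) p.1.+1 p.2.+1 `&` pe (s / N%:R) q.1.+1 q.2.+1) -
       pr (pe (s / N%:R) p.1.+1 p.2.+1) * pr (pe (s / N%:R) q.1.+1 q.2.+1))
    <= C * N%:R.
Proof.
move=> s0; have [n0 [C C0 hC]] := sum_pair_event2 s0.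
exists n0; exists (4 * C); first by rewrite mulr_ge0.
move=> N hN; set dl := s / N%:R.
pose t (a b c : 'I_N) := pr (pe dl a.+1 b.+1 `&` pe dl a.+1 c.+1).
have t0 a b c : 0 <= t a b c by exact: pr_ge0.
apply: (@le_trans _ _ (4 * \sum_a \sum_(b | b != a) \sum_(c | c != a) t a b c)).
  apply: sum_overlap_le => -[a b] [c e] /= ab ce.
  have g0 u v : 0 <= pr (pe dl u v) by exact: pr_ge0.
  have gg : 0 <= pr (pe dl a.+1 b.+1) * pr (pe dl c.+1 e.+1) by rewrite mulr_ge0.
  have z0 (u : bool) (v1 v2 v3 : 'I_N) : 0 <= u%:R * t v1 v2 v3 by rewrite mulr_ge0.
  have [ca|ca] := eqVneq c a.
    have : t a b e = pr (pe dl a.+1 b.+1 `&` pe dl c.+1 e.+1) by rewrite /t ca.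
    have := z0 (e == a) a b c; have := z0 (c == b) b a e; have := z0 (e == b) b a c.
    rewrite mul1r; lra.
  have [ea|ea] := eqVneq e a.
    have : t a b c = pr (pe dl a.+1 b.+1 `&` pe dl c.+1 e.+1).
      by rewrite /t ea (pair_eventC _ _ _ c.+1).
    have := z0 (c == b) b a e; have := z0 (e == b) b a c.
    rewrite mul1r mul0r; lra.
  have [cb|cb] := eqVneq c b.
    have : t b a e = pr (pe dl a.+1 b.+1 `&` pe dl c.+1 e.+1).
      by rewrite /t cb (pair_eventC _ _ _ a.+1).
    have := z0 (e == b) b a c.
    rewrite mul1r !mul0r; lra.
  have [eb|eb] := eqVneq e b.
    have : t b a c = pr (pe dl a.+1 b.+1 `&` pe dl c.+1 e.+1).
      by rewrite /t eb (pair_eventC _ _ _ a.+1) (pair_eventC _ _ _ c.+1).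
    rewrite mul1r !mul0r; lra.
  have u : uniq [:: a.+1; b.+1; c.+1; e.+1].
    rewrite /= !inE !eqSS !negb_or !andbT.
    rewrite -!val_eqE/= in ab ce ca ea cb eb.
    by clear -ab ce ca ea cb eb; lia.
  rewrite (pair_event_indep x mz hind)// subrr.
  by rewrite !mul0r !addr0.
rewrite -mulrA ler_pM2l//.
apply: (@le_trans _ _ (\sum_(a < N) C)); last by rewrite sumr_const card_ord mulr_natr.
apply: ler_sum => a _.
under eq_bigr => b _ do
  rewrite (sum_ord_offdiag a (fun c => pr (pe dl a.+1 b.+1 `&` pe dl a.+1 c))).
rewrite (sum_ord_offdiag a (fun b => \sum_(1 <= c < N.+1 | c != a.+1)
  pr (pe dl a.+1 b `&` pe dl a.+1 c))).
by apply: hC => //=; exact: ltn_ord.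
Qed.

(** * Almost sure convergence along the squares *)

Definition bad_event (eps s : R) (N : nat) : set T :=
  [set w | eps * N%:R <= `| (pair_count_at N s w)%:R - 2 * s * N%:R | ].

Lemma measurable_deviation (s c t : R) (N : nat) :
  measurable [set w | t <= `|(pair_count_at N s w)%:R - c| ].
Proof.
have mf : measurable_fun setT (fun w => `|(pair_count_at N s w)%:R - c| : R).
  apply: measurableT_comp => //; apply: measurable_funB => //.
  under eq_fun do rewrite pair_count_atE.
  rewrite (_ : (fun _ => _) = fun w =>
      \sum_(p <- [seq p <- index_enum ('I_N * 'I_N)%type | p.1 != p.2])
    \1_(pe (s / N%:R) p.1.+1 p.2.+1) w); last first.
    by apply/funext => w; rewrite big_filter.
  by apply: measurable_sum => p; apply: measurable_indic; exact: mpe.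
have := mf measurableT `[t, +oo[%classic (measurable_itv _); rewrite setTI.
by congr measurable; apply/seteqP; split => w; rewrite /= in_itv/= andbT.
Qed.

(** Half of eps covers the distance from the mean to 2 s N, the other half is the deviation in
    Chebyshev's inequality, where a variance O(N) is divided by a multiple of N^2. *)
Lemma pr_bad_event (eps s : R) : 0 < eps -> 0 < s ->
  exists N0 : nat, exists2 C : R, 0 <= C & forall N, (N0 < N)%N ->
    pr (bad_event eps s N) <= C / N%:R.
Proof.
move=> e0 s0.
have e2 : 0 < eps / 2 by rewrite divr_gt0.
have [n1 h1] := sum_pair_event s0 e2.
have [n2 [C C0 hC]] := pair_event_variance s0.
exists (n1 + n2)%N; exists (C / (eps / 2) ^+ 2); first by rewrite divr_ge0// sqr_ge0.
move=> N hN.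
have NR : 0 < N%:R :> R by rewrite ltr0n; nat_lia.
pose r := [seq p <- index_enum ('I_N * 'I_N)%type | p.1 != p.2].
pose E (p : 'I_N * 'I_N) := pe (s / N%:R) p.1.+1 p.2.+1.
have mE p : measurable (E p) by exact: mpe.
pose mu := \sum_(p <- r) pr (E p).
have muE : `|mu - 2 * s * N%:R| <= eps / 2 * N%:R.
  rewrite /mu big_filter (sum_offdiag (fun a b : 'I_N => pr (pe (s / N%:R) a.+1 b.+1))).
  rewrite [X in _ - X](_ : _ = \sum_(a < N) (2 * s)); last first.
    by rewrite sumr_const card_ord mulr_natr.
  rewrite -sumrB (le_trans (ler_norm_sum _ _ _))//.
  apply: (@le_trans _ _ (\sum_(a < N) (eps / 2))); last by rewrite sumr_const card_ord mulr_natr.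
  apply: ler_sum => a _.
  rewrite (sum_ord_offdiag a (fun b => pr (pe (s / N%:R) a.+1 b))).
  by apply: h1; [nat_lia|rewrite /= ltn_ord].
have t0 : 0 < eps / 2 * N%:R by rewrite mulr_gt0.
have SE w : \sum_(p <- r) \1_(E p) w = (pair_count_at N s w)%:R :> R.
  by rewrite big_filter pair_count_atE.
have mB : measurable [set w | eps / 2 * N%:R <=
    `|\sum_(p <- r) \1_(E p) w - \sum_(p <- r) pr (E p)| ].
  under eq_set => w do rewrite SE.
  exact: measurable_deviation.
have := second_moment_bound mE t0 mB.
rewrite [X in _ <= X -> _](_ : _ = \sum_(p : 'I_N * 'I_N | p.1 != p.2)
    \sum_(q : 'I_N * 'I_N | q.1 != q.2) (pr (E p `&` E q) - pr (E p) * pr (E q))); last first.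
  by rewrite big_filter; apply: eq_bigr => p _; rewrite big_filter.
have hN2 : (n2 <= N)%N by nat_lia.
move=> /le_trans/(_ (hC N hN2)).
have sub : bad_event eps s N `<=` [set w | eps / 2 * N%:R <=
    `|\sum_(p <- r) \1_(E p) w - \sum_(p <- r) pr (E p)| ].
  move=> w; rewrite /bad_event/= SE -/mu => h.
  have := ler_normD ((pair_count_at N s w)%:R - mu) (mu - 2 * s * N%:R).
  rewrite addrA subrK; lra.
have := le_pr P (measurable_deviation s (2 * s * N%:R) (eps * N%:R) N) mB sub.
set b := pr (bad_event _ _ _); set b' := pr _ => bb hb.
have h : (eps / 2 * N%:R) ^+ 2 * b <= C * N%:R.
  by apply: le_trans hb; rewrite ler_wpM2l// sqr_ge0.
rewrite ler_pdivlMr// ler_pdivlMr ?exprn_gt0//.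
rewrite -(ler_pM2r NR); apply: le_trans h; rewrite le_eqVlt; apply/orP; left.
by apply/eqP; ring.
Qed.

(** The bound C / N becomes summable along N = j^2, so Borel-Cantelli applies. *)
Lemma ae_eventually_not_bad (eps s : R) : 0 < eps -> 0 < s ->
  {ae P, forall w, exists j0 : nat, forall j, (j0 <= j)%N -> ~ bad_event eps s (j ^ 2) w}.
Proof.
move=> e0 s0; have [N0 [C C0 hC]] := pr_bad_event e0 s0.
pose F j := bad_event eps s ((j + N0).+1 ^ 2).
have mF j : measurable (F j) by exact: measurable_deviation.
have hF j : pr (F j) <= C * (j.+1%:R ^+ 2)^-1.
  apply: le_trans (hC _ _) _.
    by apply: (@leq_trans (N0.+1 ^ 2)); rewrite ?leq_exp2r//; nat_lia.
  rewrite ler_wpM2l// lef_pV2 ?posrE ?exprn_gt0 ?ltr0n ?expn_gt0//.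
  by rewrite -natrX ler_nat leq_exp2r//; nat_lia.
have psum n : \sum_(0 <= j < n) (C * (j.+1%:R ^+ 2)^-1) <= 2 * C.
  (* Telescoping with 1 / (n + 1)^2 <= 1 / n - 1 / (n + 1); for n = 0 the inverse is 0 by
     convention. *)
  suff h : \sum_(0 <= j < n) (j.+1%:R ^+ 2)^-1 <= 2 - n%:R^-1 :> R.
    rewrite -mulr_sumr mulrC ler_wpM2r//.
    by apply: le_trans h _; rewrite gerBl invr_ge0.
  elim: n => [|[|n] IH]; first by rewrite big_geq// invr0 subr0.
    by rewrite big_nat1 expr1n !invr1; lra.
  rewrite big_nat_recr//=; apply: le_trans (lerD IH (lexx _)) _.
  have v0 : 0 < n.+1%:R :> R by rewrite ltr0n.
  have -> : n.+2%:R = n.+1%:R + 1 :> R by rewrite -natr1.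
  set v : R := n.+1%:R in v0 *.
  have u0 : 0 < v + 1 by rewrite addr_gt0.
  have hv : v^-1 - (v + 1)^-1 = (v * (v + 1))^-1 by field; rewrite !gt_eqF.
  have : ((v + 1) ^+ 2)^-1 <= (v * (v + 1))^-1.
    by rewrite lef_pV2 ?posrE ?exprn_gt0 ?mulr_gt0// expr2 ler_pM2r//; lra.
  rewrite -hv; move: (v ^-1) ((v + 1)^-1) ((v + 1) ^- 2) => p q r; lra.
have sF : (\sum_(0 <= j <oo) P (F j) < +oo)%E.
  apply: (@le_lt_trans _ _ (2 * C)%:E); last exact: ltry.
  apply: lime_le; first by apply: is_cvg_nneseries => n _ _; exact: measure_ge0.
  apply: nearW => n; apply: (@le_trans _ _ (\sum_(0 <= j < n) (pr (F j))%:E)%E).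
    by apply: lee_sum => j _; rewrite prE.
  by rewrite sumEFin lee_fin; apply: le_trans (psum n); apply: ler_sum => j _.
exists (lim_sup_set F); split.
- by apply: bigcap_measurable => // n _; apply: bigcup_measurable => j _.
- exact: lim_sup_set_cvg0.
- move=> w /= hw n _; apply: contrapT => hn; apply: hw.
  exists (n + N0).+1 => j hj hbad; apply: hn.
  exists (j - N0.+1)%N; first by rewrite /=; nat_lia.
  by rewrite /F (_ : ((j - N0.+1) + N0).+1 = j)//; nat_lia.
Qed.

End Moments.

Theorem theorem2 (R : realType) (x : nat -> R) (g : R -> R)
  (g_pos : forall t : R, 0 < t -> 0 < g t)
  (g_decr : forall t u : R, 0 < t -> t <= u -> g u <= g t)
  (hgD : (fun N : nat => g N%:R / discrepancy x N) @ \oo --> +oo)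
  (hNg : (fun N : nat => N%:R * g N%:R) @ \oo --> +oo)
  (hM : (fun N : nat =>
          g (N%:R * (1 + Mdisc x N / (N%:R * g N%:R))) / g N%:R) @ \oo --> (1 : R))
  (d : measure_display) (T : measurableType d) (P : probability T R)
  (z : nat -> T -> R)
  (hunif : forall i : nat, (0 < i)%N -> uniform_sym P (z i) (g i%:R))
  (hind : mutually_independent P z) :
  {ae P, forall w : T, poissonian_pair_correlation (fun n => x n + z n w)}.
Proof.
(* Positive rational s and accuracies 1 / (k + 1) form a countable family, so the almost sure events
   can be intersected. *)
pose Q (a b k : nat) w := exists j0 : nat, forall j, (j0 <= j)%N ->
  ~ bad_event x z (k.+1%:R^-1) (a.+1%:R / b.+1%:R) (j ^ 2) w.
have hQ a b k : {ae P, forall w, Q a b k w}.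
  by apply: (ae_eventually_not_bad g_pos g_decr hgD hNg hM hunif hind);
    rewrite ?divr_gt0 ?invr_gt0.
apply: filterS (ae_foralln (fun a => ae_foralln (fun b => ae_foralln (hQ a b)))).
move=> w hw; apply: poissonian_of_squares => a b k.
have [j0 hj] := hw a b k; exists j0 => j /hj; rewrite /bad_event/= => /negP.
by rewrite -ltNge [X in _ < X -> _]mulrC; exact: ltW.
Qed.
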